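(* Let $K\subset\mathbb{R}^n$ be a convex body. Then $$e^{\mathrm{V}_1(K)-\pi\,\mathrm{R}(K)^2}\leq\mathcal{W}(K)\leq e^{\mathrm{V}_1(K)},$$ where $\mathrm{V}_1(K)$ is the first intrinsic volume of $K$, $\mathrm{R}(K)$ its circumradius and $\mathcal{W}(K)$ its Wills functional.
   Context: A convex body in $\mathbb{R}^n$ is a non-empty compact convex set; $\mathrm{vol}$ is $n$-dimensional Lebesgue measure. With $B_2^n$ the Euclidean unit ball and $\kappa_j=\mathrm{vol}_j(B_2^j)=\pi^{j/2}/\Gamma(j/2+1)$, the intrinsic volumes $\mathrm{V}_i(K)$, $0\le i\le n$, of a convex body $K$ are defined by the Steiner formula $\mathrm{vol}(K+\lambda B_2^n)=\sum_{i=0}^n\kappa_{n-i}\mathrm{V}_i(K)\lambda^{n-i}$ for all $\lambda\geq 0$. In particular $\mathrm{V}_1(K)=\frac{1}{\kappa_{n-1}}\int_{\mathbb{S}^{n-1}}h_K(u)\,du$, where $h_K(u)=\max_{z\in K}\langle z,u\rangle$ is the support function and $du$ is the (surface) Lebesgue measure on the sphere. The Wills functional is $\mathcal{W}(K)=\sum_{i=0}^n\mathrm{V}_i(K)$; equivalently, $\mathcal{W}(K)=\int_{\mathbb{R}^n}e^{-\pi d(x,K)^2}\,dx$, where $d(x,K)$ is the Euclidean distance from $x$ to $K$. The circumradius is $\mathrm{R}(K)=\min\{R\geq 0:\exists\,x\in\mathbb{R}^n\text{ with }K\subset x+RB_2^n\}$. *)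

(* Defs.v *)
From HB Require Import structures.
From mathcomp Require Import all_boot all_order all_algebra.
From mathcomp Require Import all_classical all_reals all_analysis.

Set Implicit Arguments.
Unset Strict Implicit.
Unset Printing Implicit Defensive.

Import Order.TTheory GRing.Theory Num.Theory.
Import numFieldNormedType.Exports.

Local Open Scope classical_set_scope.
Local Open Scope ring_scope.

(* R^n is 'rV[R]_n. Its library norm is the sup norm, which induces the usual
   topology (hence the usual [compact]) but is not Euclidean: the Euclidean
   norm is defined separately. *)
Definition euclidean_norm (R : realType) (n : nat) (x : 'rV[R]_n) : R :=
  Num.sqrt (\sum_(i < n) x 0 i ^+ 2).

Definition euclidean_unit_ball (R : realType) (n : nat) : set 'rV[R]_n :=
  [set x | euclidean_norm x <= 1].

Definition convex_body (R : realType) (n : nat) (K : set 'rV[R]_n) : Prop :=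
  [/\ K !=set0, compact K &
      convex_set (K : set (convex_lmodType 'rV[R]_n))].

(* n-dimensional Lebesgue measure, as the n-fold product of the
   one-dimensional one: the successor case is [product_measure1], i.e. the
   integral over the first coordinate t of the measure of the section at t,
   and R^0 carries the unit mass at its only point. It is written as a total
   function of sets; it is Lebesgue measure on Borel sets. *)
Fixpoint vol (R : realType) (n : nat) : set 'rV[R]_n -> \bar R :=
  match n return set 'rV[R]_n -> \bar R with
  | 0 => fun A => (\1_A (0 : 'rV[R]_0))%:E
  | m.+1 => fun A =>
      (\int[lebesgue_measure]_(t in [set: R])
         vol [set y : 'rV[R]_m | A (row_mx (t%:M : 'rV[R]_1) y)])%E
  end.

Definition kappa (R : realType) (j : nat) : R :=
  fine (vol (@euclidean_unit_ball R j)).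

Definition minkowski_sum (R : realType) (n : nat) (A B : set 'rV[R]_n) :
    set 'rV[R]_n :=
  [set a + b | a in A & b in B].

Definition dilation (R : realType) (n : nat) (r : R) (A : set 'rV[R]_n) :
    set 'rV[R]_n :=
  [set r *: a | a in A].

(* [V 0, ..., V n] are the intrinsic volumes of [K], as defined by the Steiner
   formula. They are unique (coefficients of a polynomial in l, as every
   [kappa j] is nonzero), and exist for every convex body by Steiner's theorem.
   The values [V i] for [n < i] are irrelevant. *)
Definition intrinsic_volumes (R : realType) (n : nat) (K : set 'rV[R]_n)
    (V : nat -> R) : Prop :=
  forall l : R, 0 <= l ->
    vol (minkowski_sum K (dilation l (@euclidean_unit_ball R n))) =
    (\sum_(i < n.+1) kappa R (n - i) * V i * l ^+ (n - i))%:E.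

(* The Wills functional of a body of R^n whose intrinsic volumes are [V]. *)
Definition wills (R : realType) (n : nat) (V : nat -> R) : R :=
  \sum_(i < n.+1) V i.

(* The infimum is attained when [K] is compact and nonempty. *)
Definition circumradius (R : realType) (n : nat) (K : set 'rV[R]_n) : R :=
  inf [set r : R | 0 <= r /\ exists x : 'rV[R]_n,
         K `<=` minkowski_sum [set x] (dilation r (@euclidean_unit_ball R n))].

(* Main.v *)
(* Write [D] for the distance to [K]. By the layer cake formula the Steiner
   polynomial turns into [int exp (- pi s^2 D(x/s)^2) dx = sum_i V_i s^i =: P s]
   for [s > 0]; the case [K = {0}] provides the moments needed, so no Gamma
   function appears. As [P 1] is the Wills functional [W], both bounds compare
   [P s] with [W^s] as [s -> 0+].
   Upper bound: [D] being a distance, [s^2 D(z/s)^2 <= (1-s)|x|^2 + s D(y)^2]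
   at [z = (1-s)x + sy], hence [W^s <= P s] by Prekopa-Leindler.
   Lower bound: if [K] lies in the ball of centre [v] and radius [r], then
   [s D(y)^2 + (1-s)|y-v|^2 <= s^2 D(x/s)^2 + s r^2] at [y = x + (1-s)v], hence
   [P s <= exp (s pi r^2) W^s] by Hoelder.
   Comparing Taylor coefficients at [0] yields first [V_0 = 1] and then
   [ln W <= V_1 <= ln W + pi r^2]. *)
From HB Require Import structures.
Require Import Defs.
From mathcomp Require Import all_boot all_order all_algebra.
From mathcomp Require Import all_classical all_reals all_analysis.
From mathcomp Require Import measurable_realfun ring lra.

Set Implicit Arguments.
Unset Strict Implicit.
Unset Printing Implicit Defensive.

Import Order.TTheory GRing.Theory Num.Theory.
Import numFieldNormedType.Exports.

Local Open Scope classical_set_scope.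
Local Open Scope ring_scope.
(** * Prekopa-Leindler on the line *)

(** For [s > 0] the function [s D(x/s)] is the distance from x to the dilate sK, so [P s] is the
    Wills functional of sK. It runs from a point body, whose integrand is a Gaussian of mass 1, to K
    itself at [s = 1], and its slope at 0 is [V 1]. The geometric interpolation [W^s] between the
    same two values has slope [ln W] at 0; this is why one-sided comparisons of the two paths give
    the two bounds. One-dimensional Brunn-Minkowski needs nonempty sets, and two functions with
    different suprema have levels at which only one superlevel set is empty. Hence functions are
    truncated and divided by an attained maximum; the resulting inequality is additive, and the
    weighted arithmetic-geometric mean inequality makes it multiplicative. At the end,
    [1 + t <= e^t] trades the exponentials for polynomials, so that only coefficients are compared
    and no derivative is taken. *)

Lemma lebesgue_measure_affine (R : realType) (a b : R) (A : set R) :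
  0 < a -> measurable A ->
  lebesgue_measure ((fun x => a * x + b) @^-1` A) =
  (a^-1%:E * lebesgue_measure A)%E.
Proof.
move=> a0 mA.
pose f : measurableTypeR R -> measurableTypeR R := fun x => a * x + b.
have mf : measurable_fun setT f.
  by apply: measurable_funD => //; exact: measurable_funM.
pose m : {measure set (measurableTypeR R) -> \bar R} :=
  mscale (NngNum (ltW a0)) (pushforward lebesgue_measure f).
(* The image of Lebesgue measure under [f], multiplied by [a], gives every half-open interval its
   length, which characterises Lebesgue measure. *)
have -> : lebesgue_measure A = m mf A.
  apply: lebesgue_measure_unique => // _ [[c d] /=] _ <-.
  rewrite /m /= /mscale /= /pushforward /=.
  have -> : f @^-1` `]c, d] = `](c - b) / a, (d - b) / a]%classic.
    apply/seteqP; split => x /=; rewrite !in_itv /= /f;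
    by rewrite ltr_pdivrMr// ler_pdivlMr// ltrBlDr lerBrDr (mulrC x).
  rewrite !lebesgue_measure_itv /= !lte_fin ltr_pM2r ?invr_gt0// ltrD2r.
  by case: ifP => _; rewrite ?mule0// -EFinM; congr EFin; field; rewrite gt_eqF.
by rewrite /m /= /mscale /= muleA -EFinM mulVf ?gt_eqF// mul1e.
Qed.

Lemma integral_affine (R : realType) (a b : R) (f : R -> \bar R) :
  0 < a -> measurable_fun setT f -> (forall x, 0 <= f x)%E ->
  (\int[lebesgue_measure]_x f (a * x + b)%R =
   a^-1%:E * \int[lebesgue_measure]_x f x)%E.
Proof.
move=> a0 mf f0.
pose g : measurableTypeR R -> measurableTypeR R := fun x => a * x + b.
have mg : measurable_fun setT g.
  by apply: measurable_funD => //; exact: measurable_funM.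
have an : 0 <= a^-1 by rewrite invr_ge0 ltW.
transitivity (\int[pushforward lebesgue_measure g]_x f x)%E.
  by rewrite ge0_integral_pushforward.
transitivity (\int[mscale (NngNum an) lebesgue_measure]_x f x)%E.
  by apply: eq_measure_integral => A mA _; exact: lebesgue_measure_affine.
by rewrite ge0_integral_mscale.
Qed.

(** * Brunn-Minkowski inequality on the line *)

Lemma lebesgue_measure_shift (R : realType) (b : R) (A : set R) :
  measurable A ->
  lebesgue_measure ((fun x => x + b) @^-1` A) = lebesgue_measure A.
Proof.
move=> mA; have := lebesgue_measure_affine b (@ltr01 R) mA.
rewrite invr1 mul1e => <-; congr lebesgue_measure.
by apply/seteqP; split => x /=; rewrite mul1r.
Qed.

(** The translates of [A] by the minimum [b0] of [B] and of [B] by the maximum [a0] of [A] both lie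
    in [C]. The first is to the left of [a0 + b0] and the second to its right, so they share at most
    one point. *)
Lemma compact_add_lebesgue_measure (R : realType) (A B C : set R) :
  compact A -> compact B -> measurable C -> A !=set0 -> B !=set0 ->
  (forall a b, A a -> B b -> C (a + b)) ->
  (lebesgue_measure A + lebesgue_measure B <= lebesgue_measure C)%E.
Proof.
move=> cA cB mC A0 B0 ABC.
have idcont (D : set R) : {within D, continuous id}.
  by apply: continuous_subspaceT => x; exact: cvg_id.
have [a0 /set_mem Aa0 a0max] := compact_EVT_max A0 cA (idcont A).
have [b0 /set_mem Bb0 b0min] := compact_EVT_min B0 cB (idcont B).
pose P := (fun x : R => x + - b0) @^-1` A.
pose Q := (fun x : R => x + - a0) @^-1` B.
have mshift c D : measurable D -> measurable ((fun x : R => x + c) @^-1` D).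
  by move=> mD; rewrite -[X in measurable X]setTI; apply: measurable_funD.
have mP : measurable P by apply: mshift; exact: compact_measurable.
have mQ : measurable Q by apply: mshift; exact: compact_measurable.
have <- : lebesgue_measure P = lebesgue_measure A.
  by apply: lebesgue_measure_shift; exact: compact_measurable.
have EQ : lebesgue_measure Q = lebesgue_measure B.
  by apply: lebesgue_measure_shift; exact: compact_measurable.
have Qfin : (lebesgue_measure Q < +oo)%E.
  by rewrite EQ; exact: compact_finite_measure.
have PQ0 : lebesgue_measure (P `&` Q) = 0%E.
  apply/eqP; rewrite -measure_le0 -(lebesgue_measure_set1 (a0 + b0)).
  apply: le_measure; rewrite ?inE//; first exact: measurableI.
  move=> x [/= Px Qx].
  have := a0max _ (mem_set Px); have := b0min _ (mem_set Qx) => /=; lra.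
rewrite -EQ -[leLHS]sube0 -PQ0 -measureUfinr//.
apply: le_measure; rewrite ?inE//; first exact: measurableU.
move=> x [Px|Qx].
- by have := ABC _ _ Px Bb0; rewrite subrK.
- by have := ABC _ _ Aa0 Qx; rewrite addrC subrK.
Qed.

(** Inner regularity, applied to [A] and [B] in turn. A measurable [C] containing the sums stands in
    for the sumset, which need not be measurable. *)
Lemma add_lebesgue_measure (R : realType) (A B C : set R) :
  measurable A -> measurable B -> measurable C -> A !=set0 -> B !=set0 ->
  (forall a b, A a -> B b -> C (a + b)) ->
  (lebesgue_measure A + lebesgue_measure B <= lebesgue_measure C)%E.
Proof.
move=> mA mB mC [a Aa] [b Bb] ABC.
have [->|Cfin] := eqVneq (lebesgue_measure C) +oo%E; first exact: leey.
have Cf : lebesgue_measure C \is a fin_num.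
  by rewrite ge0_fin_numE ?ltey.
have step (K L : set R) : compact K -> compact L -> K `<=` A -> L `<=` B ->
    (lebesgue_measure K + lebesgue_measure L <= lebesgue_measure C)%E.
  move=> cK cL KA LB.
  (* The compact case excludes empty sets; here the translate of [L] by a point of [A] already fits
     in [C]. *)
  have [->|/set0P K0] := eqVneq K set0.
    rewrite measure0 add0e -(lebesgue_measure_shift (- a) (compact_measurable cL)).
    apply: le_measure; rewrite ?inE//.
      rewrite -[X in measurable X]setTI; apply: measurable_funD => //.
      exact: compact_measurable.
    by move=> x /= Lx; have := ABC _ _ Aa (LB _ Lx); rewrite addrC subrK.
  have [->|/set0P L0] := eqVneq L set0.
    rewrite measure0 adde0 -(lebesgue_measure_shift (- b) (compact_measurable cK)).
    apply: le_measure; rewrite ?inE//.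
      rewrite -[X in measurable X]setTI; apply: measurable_funD => //.
      exact: compact_measurable.
    by move=> x /= Kx; have := ABC _ _ (KA _ Kx) Bb; rewrite subrK.
  by apply: compact_add_lebesgue_measure => // x y /KA + /LB; exact: ABC.
have stepA (L : set R) : compact L -> L `<=` B ->
    (lebesgue_measure A + lebesgue_measure L <= lebesgue_measure C)%E.
  move=> cL LB; rewrite -lee_suber_addr// lebesgue_regularity_inner_sup//.
  apply: ge_ereal_sup => _ [K [cK KA] <-].
  by rewrite lee_suber_addr// step.
rewrite -lee_suber_addl// [leLHS]lebesgue_regularity_inner_sup//.
apply: ge_ereal_sup => _ [L [cL LB] <-].
by rewrite lee_suber_addl// stepA.
Qed.

(** * Layer cake formula *)

Section layer_cake.
Context d (T : measurableType d) (R : realType).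
Variable mu : {sigma_finite_measure set T -> \bar R}.
Variable f : T -> R.
Hypothesis mf : measurable_fun setT f.
Hypothesis f0 : forall x, 0 <= f x.

Let S : set (T * measurableTypeR R) := [set p | (0 < p.2) && (p.2 <= f p.1)].

Let mS : measurable S.
Proof.
have m2 : measurable_fun [set: T * measurableTypeR R] (@snd T (measurableTypeR R)).
  exact: measurable_snd.
have m1 : measurable_fun [set: T * measurableTypeR R] (fun p => f p.1).
  by apply: measurableT_comp => //; exact: measurable_fst.
have h : measurable_fun setT
    (fun p : T * measurableTypeR R => (0 < p.2) && (p.2 <= f p.1)).
  apply: measurable_and.
    by apply: (@measurable_fun_ltr _ _ R _ (cst 0)).
  by apply: (@measurable_fun_ler _ _ R).
rewrite -[X in measurable X]setTI.
by have := h measurableT [set true] Logic.I; congr measurable.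
Qed.

Let g (p : T * measurableTypeR R) : \bar R := (\1_S p)%:E.

Let mg : measurable_fun setT g.
Proof. by apply/measurable_EFinP; exact: measurable_indic. Qed.

Let g0 p : (0 <= g p)%E. Proof. by rewrite lee_fin. Qed.

Let section (c : R) : (\int[mu]_x g (x, c))%E = mu [set x | (0 < c) && (c <= f x)].
Proof.
have mSc : measurable [set x | (0 < c) && (c <= f x)].
  by rewrite (_ : [set _ | _] = ysection S c); [exact: measurable_ysection|
    apply/seteqP; split => x; rewrite /ysection /= inE].
transitivity (\int[mu]_x (\1_[set x | (0 < c) && (c <= f x)] x)%:E)%E.
  2: by rewrite integral_indic// setIT.
apply: eq_integral => x _.
by rewrite /g !indicE; congr (_ _)%:E; congr (nat_of_bool _); apply/idP/idP; rewrite !inE.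
Qed.

Lemma measurable_superlevel_measure :
  measurable_fun [set: measurableTypeR R]
    (fun c => mu [set x | (0 < c) && (c <= f x)]).
Proof.
rewrite (_ : (fun c => _) = fubini_G mu g).
  exact: measurable_fun_fubini_tonelli_G.
by apply/funext => c; rewrite -section.
Qed.

(** Tonelli for the indicator of the region [S] below the graph of [f], whose section at [x] is an
    interval of length [f x]. *)
Lemma layer_cake : (\int[mu]_x (f x)%:E =
  \int[lebesgue_measure]_c mu [set x | ((0 < c) && (c <= f x))%R])%E.
Proof.
under [RHS]eq_integral do rewrite -section.
rewrite -(@fubini_tonelli _ _ _ _ _ mu (@lebesgue_measure R) g)//.
apply: eq_integral => x _.
pose I : set R := `]0, f x]%classic.
have <- : lebesgue_measure I = (f x)%:E.
  rewrite lebesgue_measure_itv /= lte_fin oppr0 addr0.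
  by have := f0 x; rewrite le_eqVlt => /orP[/eqP <-|->//]; rewrite ltxx.
transitivity (\int[lebesgue_measure]_c (\1_I c)%:E)%E.
  by rewrite integral_indic ?setIT//; exact: measurable_itv.
by apply: eq_integral => c _; rewrite /g !indicE.
Qed.

End layer_cake.

Lemma convex_lebesgue_measure (R : realType) (p q : R) (A B C : set R) :
  0 < p -> 0 < q ->
  measurable A -> measurable B -> measurable C -> A !=set0 -> B !=set0 ->
  (forall a b, A a -> B b -> C (p * a + q * b)) ->
  (p%:E * lebesgue_measure A + q%:E * lebesgue_measure B <=
   lebesgue_measure C)%E.
Proof.
have scale (r : R) (D : set R) : 0 < r -> measurable D ->
    measurable ((fun x => r^-1 * x + 0) @^-1` D) /\
    lebesgue_measure ((fun x => r^-1 * x + 0) @^-1` D) =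
    (r%:E * lebesgue_measure D)%E.
  move=> r0 mD; split; last first.
    by rewrite lebesgue_measure_affine ?invr_gt0// invrK.
  rewrite -[X in measurable X]setTI; apply: measurable_funD => //.
move=> p0 q0 mA mB mC [a Aa] [b Bb] ABC.
have [mA' <-] := scale _ _ p0 mA; have [mB' <-] := scale _ _ q0 mB.
apply: add_lebesgue_measure => //.
- by exists (p * a); rewrite /= addr0 mulKf ?gt_eqF.
- by exists (q * b); rewrite /= addr0 mulKf ?gt_eqF.
- move=> x y /= Ax By; have := ABC _ _ Ax By.
  by rewrite !addr0 !mulVKf ?gt_eqF.
Qed.

(* Since [u] and [v] both attain their maximum 1, their superlevel sets at every
   level in ]0, 1] are nonempty, and the one-dimensional Brunn-Minkowski
   inequality applies level by level. *)
Lemma prekopa_leindler_min (R : realType) (p q x0 y0 : R) (u v w : R -> R) :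
  0 < p -> 0 < q ->
  measurable_fun setT u -> measurable_fun setT v -> measurable_fun setT w ->
  (forall x, 0 <= u x <= 1) -> (forall x, 0 <= v x <= 1) ->
  (forall x, 0 <= w x) -> u x0 = 1 -> v y0 = 1 ->
  (forall x y, Num.min (u x) (v y) <= w (p * x + q * y)) ->
  (p%:E * \int[lebesgue_measure]_x (u x)%:E +
   q%:E * \int[lebesgue_measure]_x (v x)%:E <=
   \int[lebesgue_measure]_x (w x)%:E)%E.
Proof.
move=> p0 q0 mu mv mw u01 v01 w0 ux0 vy0 uvw.
have u0 x : 0 <= u x by case/andP: (u01 x).
have v0 x : 0 <= v x by case/andP: (v01 x).
have mlevel (h : R -> R) c : measurable_fun setT h ->
    measurable [set x | (0 < c) && (c <= h x)].
  move=> mh; rewrite -[X in measurable X]setTI.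
  have mb : measurable_fun setT (fun x => (0 < c) && (c <= h x)).
    apply: measurable_and; first by apply: measurable_fun_ltr.
    by apply: measurable_fun_ler.
  by have := mb measurableT [set true] Logic.I; congr measurable.
have level0 (h : R -> R) c : (forall x, 0 <= h x <= 1) -> ~~ (0 < c <= 1) ->
    lebesgue_measure [set x | (0 < c) && (c <= h x)] = 0%E.
  move=> h01 c01; rewrite (_ : [set _ | _] = set0) ?measure0//.
  apply/seteqP; split => x //= /andP[c0 ch]; case/negP: c01.
  by rewrite c0 (le_trans ch)//; case/andP: (h01 x).
rewrite !(layer_cake (@lebesgue_measure R)) //.
have mU := measurable_superlevel_measure (@lebesgue_measure R) mu.
have mV := measurable_superlevel_measure (@lebesgue_measure R) mv.
have mW := measurable_superlevel_measure (@lebesgue_measure R) mw.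
rewrite -!ge0_integralZl//; last 2 first.
- by rewrite lee_fin ltW.
- by rewrite lee_fin ltW.
rewrite -ge0_integralD//; last 4 first.
- by move=> c _; rewrite mule_ge0// lee_fin ltW.
- exact: measurable_funeM.
- by move=> c _; rewrite mule_ge0// lee_fin ltW.
- exact: measurable_funeM.
apply: ge0_le_integral => //.
- by move=> c _; rewrite adde_ge0// mule_ge0// lee_fin ltW.
- by apply: emeasurable_funD; exact: measurable_funeM.
move=> c _; have [/andP[c0 c1]|c01] := boolP (0 < c <= 1); last first.
  rewrite [X in (_ * X + _)%E](level0 u c u01 c01).
  by rewrite [X in (_ + _ * X)%E](level0 v c v01 c01) !mule0 adde0.
apply: convex_lebesgue_measure => //; try exact: mlevel.
- by exists x0; rewrite /= c0 ux0.
- by exists y0; rewrite /= c0 vy0.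
move=> x y /= /andP[_ cu] /andP[_ cv]; rewrite c0 (le_trans _ (uvw _ _))//.
by rewrite le_min cu.
Qed.

(** * From superlevel sets to the multiplicative inequality *)

Lemma weighted_amgm (R : realType) (p q x y : R) :
  0 < p -> 0 < q -> p + q = 1 -> 0 <= x -> 0 <= y ->
  x `^ p * y `^ q <= p * x + q * y.
Proof.
move=> p0 q0 pq x0 y0.
have := @conjugate_powR R (x `^ p) (y `^ q) p^-1 q^-1 (powR_ge0 _ _)
  (powR_ge0 _ _).
rewrite !invr_gt0 !invrK -!powRrM !divff ?gt_eqF// !powRr1// => /(_ p0 q0 pq).
by rewrite (mulrC x) (mulrC y).
Qed.

(** Lets a possibly infinite integral [A] be replaced by an arbitrary positive real strictly below
    it. *)
Lemma poweRM_lim (R : realType) (p : R) (A c h : \bar R) :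
  0 < p -> (0 <= A)%E -> (0 <= c)%E -> (0 <= h)%E ->
  (forall a : R, 0 < a -> (a%:E < A)%E -> ((a `^ p)%:E * c <= h)%E) ->
  (A `^ p * c <= h)%E.
Proof.
move=> p0 A0 c0 h0 H.
have [->|A_neq0] := eqVneq A 0%E; first by rewrite poweR0r ?gt_eqF// mul0e.
have {}A0 : (0 < A)%E by rewrite lt_neqAle eq_sym A_neq0.
have [->|h_neqy] := eqVneq h +oo%E; first exact: leey.
have [a a0 aA] : exists2 a : R, 0 < a & (a%:E < A)%E.
  case: A A0 {H A_neq0} => [r| |] //.
  - rewrite lte_fin => r0; exists (r / 2); first by rewrite divr_gt0.
    by rewrite lte_fin ltr_pdivrMr// mulr_natr mulr2n ltrDl.
  - by exists 1 => //; rewrite ltry.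
have [->|c_neq0] := eqVneq c 0%E; first by rewrite mule0.
have ap0 : 0 < a `^ p by rewrite powR_gt0.
have cfin : c \is a fin_num.
  rewrite ge0_fin_numE// ltey; apply/eqP => cy.
  by have := H _ a0 aA; rewrite cy gt0_muley ?lte_fin// leye_eq (negPf h_neqy).
have hfin : h \is a fin_num by rewrite ge0_fin_numE// ltey.
move: H; rewrite -(fineK cfin) -(fineK hfin) => H.
have cf0 : 0 < fine c by rewrite fine_gt0// lt_neqAle eq_sym c_neq0 c0 ltey_eq cfin.
(* The largest real whose [p]-th power times [c] stays below [h]; it bounds every real below [A],
   hence [A]. *)
set k := (fine h / fine c) `^ p^-1.
have hc0 : 0 <= fine h / fine c by rewrite divr_ge0 ?fine_ge0.
have Hk b : 0 < b -> (b%:E < A)%E -> b <= k.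
  move=> b0 bA; have := H _ b0 bA; rewrite -EFinM lee_fin -ler_pdivlMr// => bk.
  have : (b `^ p) `^ p^-1 <= k.
    by rewrite ge0_ler_powR ?nnegrE ?powR_ge0// ?invr_ge0 ltW.
  by rewrite -powRrM divff ?gt_eqF// powRr1// ltW.
have kp : k `^ p = fine h / fine c by rewrite -powRrM mulVf ?gt_eqF// powRr1.
have Ak : (A <= k%:E)%E.
  rewrite leNgt; apply/negP => kA.
  have k0 : 0 < k by rewrite (lt_le_trans a0)// Hk.
  have [b kb bA] : exists2 b : R, k < b & (b%:E < A)%E.
    case: A kA {A0 A_neq0 H Hk aA} => [r| |] //.
    - rewrite lte_fin => kr; exists ((k + r) / 2); rewrite ?lte_fin; lra.
    - by exists (k + 1); rewrite ?ltry// ltrDl.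
  by have := Hk _ (lt_trans k0 kb) bA; rewrite leNgt kb.
apply: (@le_trans _ _ ((k `^ p)%:E * (fine c)%:E)%E).
  rewrite lee_wpmul2r ?lee_fin ?(ltW cf0)// -poweR_EFin.
  apply: gt0_ler_poweR => //; first exact: ltW.
    by rewrite in_itv /= (ltW A0) leey.
  by rewrite in_itv /= lee_fin powR_ge0 leey.
by rewrite -EFinM lee_fin kp divfK ?gt_eqF.
Qed.
Section truncation.
Import HBNNSimple.

(** A simple function [h] below [F] with integral above [a] has finitely many values, so it attains
    its maximum [r]. Truncating [F] at [r] keeps it above [h], and the truncation attains [r] at the
    same point. *)
Lemma lt_integral_truncation d (T : measurableType d) (R : realType)
    (mu : {measure set T -> \bar R}) (F : T -> \bar R) (a : R) :
  measurable_fun setT F -> (forall x, 0 <= F x)%E -> 0 <= a ->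
  (a%:E < \int[mu]_x F x)%E ->
  exists x0 (r : R), [/\ 0 < r, (r%:E <= F x0)%E &
    (a%:E < \int[mu]_x mine (F x) r%:E)%E].
Proof.
move=> mF F0 a0; rewrite ge0_integralTE// => /ereal_sup_gt[_ [/= h hF <-]].
rewrite -integralT_nnsfun => ah.
have [x0 hx0] : exists x0, 0 < h x0.
  apply: contrapT => /forallNP h_le0; move: ah.
  rewrite integral0_eq; first by rewrite lte_fin ltNge a0.
  move=> x _; congr EFin; apply/eqP; rewrite eq_le fun_ge0 andbT leNgt.
  exact/negP.
have range0 : range h !=set0 by exists (h x0); exists x0.
have idcont : {within range h, continuous id}.
  by apply: continuous_subspaceT => x; exact: cvg_id.
have [_ /set_mem[x1 _ <-] hmax] :=
  compact_EVT_max range0 (finite_compact (fimfunP h)) idcont.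
have {}hmax x : h x <= h x1 by apply: hmax; rewrite inE; exists x.
exists x1, (h x1); split => //; first exact: lt_le_trans (hmax x0).
apply: (lt_le_trans ah); apply: ge0_le_integral => //.
- by move=> x _; rewrite lee_fin fun_ge0.
- exact/measurable_EFinP.
- exact: measurable_mine.
- by move=> x _; rewrite le_min hF lee_fin hmax.
Qed.

End truncation.

Section prekopa_leindler_line.
Variables (R : realType) (p q : R).
Hypotheses (p0 : 0 < p) (q0 : 0 < q) (pq : p + q = 1).

(** The truncations of [F] and [G], divided by [a] and [b], attain the maximum 1. Truncating [H] at
    [c], the product of the corresponding powers of [a] and [b], and dividing by [c] gives the third
    function. *)
Lemma prekopa_leindler_truncated (F G H : R -> \bar R) (x0 y0 a b : R) :
  measurable_fun setT F -> measurable_fun setT G -> measurable_fun setT H ->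
  (forall x, 0 <= F x)%E -> (forall x, 0 <= G x)%E -> (forall x, 0 <= H x)%E ->
  (forall x y, F x `^ p * G y `^ q <= H (p * x + q * y)%R)%E ->
  0 < a -> 0 < b -> (a%:E <= F x0)%E -> (b%:E <= G y0)%E ->
  ((a `^ p * b `^ q)%:E *
    ((p / a)%:E * \int[lebesgue_measure]_x mine (F x) a%:E +
     (q / b)%:E * \int[lebesgue_measure]_x mine (G x) b%:E) <=
   \int[lebesgue_measure]_x H x)%E.
Proof.
move=> mF mG mH F0 G0 H0 FGH a0 b0 aF bG.
have nrm (h : R -> \bar R) c : 0 < c -> measurable_fun setT h ->
    (forall x, 0 <= h x)%E ->
    [/\ forall x, (fine (mine (h x) c%:E))%:E = mine (h x) c%:E,
        measurable_fun setT (fun x => fine (mine (h x) c%:E) / c),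
        forall x, 0 <= fine (mine (h x) c%:E) / c <= 1 &
        (\int[lebesgue_measure]_x mine (h x) c%:E =
        c%:E * \int[lebesgue_measure]_x (fine (mine (h x) c%:E) / c)%:E)%E].
  move=> c0 mh h0.
  have hm0 x : (0 <= mine (h x) c%:E)%E by rewrite le_min h0 lee_fin ltW.
  have hfin x : (fine (mine (h x) c%:E))%:E = mine (h x) c%:E.
    rewrite fineK// ge0_fin_numE//.
    by apply: (@le_lt_trans _ _ c%:E); rewrite ?ltry// ge_min lexx orbT.
  have mmin : measurable_fun setT (fun x => fine (mine (h x) c%:E)).
    by apply: measurableT_comp => //; exact: measurable_mine.
  split => //.
  - exact: measurable_funM.
  - move=> x; rewrite divr_ge0 ?fine_ge0 ?(ltW c0)//= ler_pdivrMr// mul1r.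
    by rewrite -lee_fin hfin ge_min lexx orbT.
  rewrite -ge0_integralZl//.
  - by apply: eq_integral => x _; rewrite -hfin -EFinM mulrC divfK ?gt_eqF.
  - by apply/measurable_EFinP; exact: measurable_funM.
  - by move=> x _; rewrite lee_fin divr_ge0 ?fine_ge0 ?(ltW c0).
  - by rewrite lee_fin ltW.
set c := a `^ p * b `^ q.
have c0 : 0 < c by rewrite mulr_gt0// powR_gt0.
have [Ffin mu u01 ->] := nrm F a a0 mF F0.
have [Gfin mv v01 ->] := nrm G b b0 mG G0.
have [Hfin mw w01 Hint] := nrm H c c0 mH H0.
set u := fun x => _ / a in mu u01 *; set v := fun x => _ / b in mv v01 *.
set w := fun x => _ / c in mw w01 Hint *.
rewrite !muleA -!EFinM !divfK ?gt_eqF//.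
apply: (@le_trans _ _ (\int[lebesgue_measure]_x mine (H x) c%:E)%E); last first.
  apply: ge0_le_integral => //.
  - by move=> x _; rewrite le_min H0 lee_fin ltW.
  - exact: measurable_mine.
  - by move=> x _; rewrite ge_min lexx.
rewrite Hint; apply: lee_wpmul2l; first by rewrite lee_fin ltW.
apply: (@prekopa_leindler_min _ _ _ x0 y0) => //.
- by move=> x; case/andP: (w01 x).
- by rewrite /u min_r// divff ?gt_eqF.
- by rewrite /v min_r// divff ?gt_eqF.
move=> x y; set m := Num.min _ _.
have m0 : 0 <= m by rewrite le_min; case/andP: (u01 x) => ->; case/andP: (v01 y).
rewrite /w ler_pdivlMr// -lee_fin Hfin le_min; apply/andP; split; last first.
  rewrite lee_fin ler_piMl ?(ltW c0)// /m ge_min.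
  by case/andP: (u01 x) => _ ->.
apply: le_trans (FGH x y).
(* As [p + q = 1], a common factor [m] passes through the geometric mean; [m * a] and [m * b] are at
   most [F x] and [G y]. *)
have mcE : m * c = (m * a) `^ p * (m * b) `^ q.
  rewrite !powRM ?(ltW a0) ?(ltW b0)// mulrACA; congr (_ * _).
  have [->|mn0] := eqVneq m 0; first by rewrite !powR0 ?gt_eqF// mulr0.
  by rewrite -powRD ?pq ?powRr1// mn0 implybT.
rewrite mcE EFinM -!poweR_EFin; apply: lee_pmul; rewrite ?poweR_ge0//.
  apply: gt0_ler_poweR; rewrite ?(ltW p0)// ?in_itv/= ?F0 ?leey ?lee_fin;
    rewrite ?mulr_ge0 ?(ltW a0)//.
  apply: (@le_trans _ _ (mine (F x) a%:E)); last by rewrite ge_min lexx.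
  by rewrite -Ffin lee_fin -ler_pdivlMr// ge_min lexx.
apply: gt0_ler_poweR; rewrite ?(ltW q0)// ?in_itv/= ?G0 ?leey ?lee_fin;
  rewrite ?mulr_ge0 ?(ltW b0)//.
apply: (@le_trans _ _ (mine (G y) b%:E)); last by rewrite ge_min lexx.
by rewrite -Gfin lee_fin -ler_pdivlMr// ge_min lexx orbT.
Qed.

Lemma prekopa_leindler1 (F G H : R -> \bar R) :
  measurable_fun setT F -> measurable_fun setT G -> measurable_fun setT H ->
  (forall x, 0 <= F x)%E -> (forall x, 0 <= G x)%E -> (forall x, 0 <= H x)%E ->
  (forall x y, F x `^ p * G y `^ q <= H (p * x + q * y)%R)%E ->
  ((\int[lebesgue_measure]_x F x) `^ p * (\int[lebesgue_measure]_x G x) `^ q <=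
   \int[lebesgue_measure]_x H x)%E.
Proof.
move=> mF mG mH F0 G0 H0 FGH.
apply: poweRM_lim; rewrite ?poweR_ge0 ?integral_ge0// => a a0 aF.
rewrite muleC; apply: poweRM_lim; rewrite ?lee_fin ?powR_ge0 ?integral_ge0// => b b0 bG.
have [x0 [r [r0 rF {}aF]]] :=
  @lt_integral_truncation _ (measurableTypeR R) R lebesgue_measure F a mF F0 (ltW a0) aF.
have [y0 [t [t0 tG {}bG]]] :=
  @lt_integral_truncation _ (measurableTypeR R) R lebesgue_measure G b mG G0 (ltW b0) bG.
apply: le_trans (prekopa_leindler_truncated mF mG mH F0 G0 H0 FGH r0 t0 rF tG).
(* The heights [r] and [t] are pulled out so that the arithmetic-geometric mean inequality applies
   to the normalised values [a / r] and [b / t]. *)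
have -> : ((b `^ q)%:E * (a `^ p)%:E =
    (r `^ p * t `^ q)%:E * ((a / r) `^ p * (b / t) `^ q)%:E)%E.
  rewrite -!EFinM mulrACA -!powRM ?(ltW a0, ltW b0, ltW r0, ltW t0)//; last 2 first.
  - by rewrite divr_ge0// ltW.
  - by rewrite divr_ge0// ltW.
  by rewrite ![_ * (_ / _)]mulrC !divfK ?gt_eqF// mulrC.
rewrite lee_wpmul2l ?lee_fin ?mulr_ge0 ?powR_ge0//.
apply: (@le_trans _ _ ((p / r)%:E * a%:E + (q / t)%:E * b%:E)%E); last first.
  by apply: leeD; apply: lee_wpmul2l; rewrite ?lee_fin ?divr_ge0 ?ltW.
rewrite -!EFinM -EFinD lee_fin -!mulrA ![_^-1 * _]mulrC.
by apply: weighted_amgm => //; rewrite divr_ge0// ltW.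
Qed.

End prekopa_leindler_line.
(** * Lebesgue measure and Prekopa-Leindler on R^n *)

Section sigma_finite_product.
Context d1 d2 (T1 : measurableType d1) (T2 : measurableType d2) (R : realType).
Variable m1 : {sigma_finite_measure set T1 -> \bar R}.
Variable m2 : {sigma_finite_measure set T2 -> \bar R}.

(* The library's sigma-finiteness instance on [m1 \x m2] is shadowed by its
   subprobability instance; this alias restores it. *)
Definition sigma_finite_product : set (T1 * T2) -> \bar R := (m1 \x m2)%E.

HB.instance Definition _ := Measure.copy sigma_finite_product (m1 \x m2)%E.

Lemma sigma_finite_productT : sigma_finite [set: T1 * T2] sigma_finite_product.
Proof.
have /sigma_finiteP[F [TF ndF Foo]] := sigma_finiteT m1.
have /sigma_finiteP[G [TG ndG Goo]] := sigma_finiteT m2.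
exists (fun n => F n `*` G n).
  rewrite -setXTT TF TG; apply/seteqP; split => -[x y].
    move=> [/= [n _ Fnx] [k _ Gky]]; exists (maxn n k) => //; split.
      by move: x Fnx; apply/subsetPset/ndF/leq_maxl.
    by move: y Gky; apply/subsetPset/ndG/leq_maxr.
  by move=> [n _ []/= ? ?]; split; exists n.
move=> k; have [? ?] := Foo k; have [? ?] := Goo k.
split; first exact: measurableX.
by rewrite /sigma_finite_product product_measure1E// lte_mul_pinfty// ge0_fin_numE.
Qed.

HB.instance Definition _ := Measure_isSigmaFinite.Build _ _ _
  sigma_finite_product sigma_finite_productT.

End sigma_finite_product.

(* R^n as an iterated product following the recursion of [vol], so that Tonelli's
   theorem applies coordinate by coordinate. *)
Fixpoint coord_display (R : realType) (n : nat) : measure_display :=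
  if n is m.+1
  then (((R.-ocitv.-measurable).-sigma, coord_display R m).-prod)%mdisp
  else default_measure_display.

Fixpoint coord (R : realType) (n : nat) : measurableType (coord_display R n) :=
  if n is m.+1 then (measurableTypeR R * coord R m)%type else unit.

Fixpoint coord_rV (R : realType) (n : nat) : coord R n -> 'rV[R]_n :=
  if n is m.+1 then fun x => row_mx (x.1%:M : 'rV[R]_1) (coord_rV x.2)
  else fun=> 0.

Fixpoint coord_measure (R : realType) (n : nat) :
    {sigma_finite_measure set (coord R n) -> \bar R} :=
  match n return {sigma_finite_measure set (coord R n) -> \bar R} with
  | 0 => (@dirac _ unit tt R : {sigma_finite_measure set unit -> \bar R})
  | m.+1 => (sigma_finite_product (@lebesgue_measure R) (coord_measure R m)
      : {sigma_finite_measure set (measurableTypeR R * coord R m)%type -> \bar R})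
  end.

(** Both sides unfold to the same iterated integral over sections, so they agree on every set. *)
Lemma vol_coord_measure (R : realType) (n : nat) (A : set 'rV[R]_n) :
  vol A = coord_measure R n (@coord_rV R n @^-1` A).
Proof.
elim: n A => [|n IH] A.
  by rewrite /= /dirac /= !indicE.
rewrite /= /product_measure1; apply: eq_integral => t _.
rewrite IH /=; congr (coord_measure R n _).
by apply/seteqP; split => x /=; rewrite /xsection /= inE.
Qed.

Section coord.
Context (R : realType).

Lemma measurable_rV_section n (f : 'rV[R]_n.+1 -> \bar R) (t : R) :
  measurable_fun setT (f \o @coord_rV R n.+1) ->
  measurable_fun setT ((fun y => f (row_mx t%:M y)) \o @coord_rV R n).
Proof. by move=> mf; exact: (measurable_fun_pair2 t mf). Qed.

Lemma measurable_rV_integral n (f : 'rV[R]_n.+1 -> \bar R) :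
  measurable_fun setT (f \o @coord_rV R n.+1) -> (forall x, 0 <= f x)%E ->
  measurable_fun [set: measurableTypeR R] (fun t : R =>
    \int[coord_measure R n]_y f (row_mx t%:M (coord_rV y)))%E.
Proof.
move=> mf f0.
exact: (@measurable_fun_fubini_tonelli_F _ _ (measurableTypeR R) _ R
  (coord_measure R n) _ mf (fun=> f0 _)).
Qed.

Lemma integral_rV_recl n (f : 'rV[R]_n.+1 -> \bar R) :
  measurable_fun setT (f \o @coord_rV R n.+1) -> (forall x, 0 <= f x)%E ->
  (\int[coord_measure R n.+1]_x f (coord_rV x) = \int[lebesgue_measure]_t
    \int[coord_measure R n]_y f (row_mx t%:M (coord_rV y)))%E.
Proof.
move=> mf f0.
exact: (@fubini_tonelli1 _ _ (measurableTypeR R) _ R (@lebesgue_measure R)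
  (coord_measure R n) _ mf (fun=> f0 _)).
Qed.

Lemma integral_rV0 (f : 'rV[R]_0 -> \bar R) :
  (\int[coord_measure R 0]_x f (coord_rV x) = f 0%R)%E.
Proof. by rewrite integral_dirac // diracT mul1e. Qed.

Lemma row_mx_linear n (a b t u : R) (x y : 'rV[R]_n) :
  row_mx ((a * t + b * u)%:M : 'rV_1) (a *: x + b *: y) =
  a *: row_mx t%:M x + b *: row_mx u%:M y.
Proof. by rewrite !scale_row_mx add_row_mx !scale_scalar_mx -raddfD. Qed.

Lemma rV_recl n (v : 'rV[R]_n.+1) :
  v = row_mx (v 0 0)%:M (@rsubmx _ 1 1 n v).
Proof.
have <- : @lsubmx _ 1 1 n v = (v 0 0)%:M.
  apply/rowP => i; rewrite !ord1 !mxE /= mulr1n.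
  by congr (v _ _); apply/val_inj.
exact/esym/(@hsubmxK _ 1 1 n v).
Qed.

Lemma row_mx_affine n (a t : R) (x : 'rV[R]_n) (v : 'rV[R]_n.+1) :
  a *: row_mx t%:M x + v =
  row_mx ((a * t + v 0 0)%:M : 'rV_1) (a *: x + @rsubmx _ 1 1 n v).
Proof.
have := row_mx_linear a 1 t (v 0 0) x (@rsubmx _ 1 1 n v).
rewrite !scale1r mul1r => ->; rewrite {1}[v]rV_recl; exact: erefl.
Qed.

(** Tensorisation: the inequality in dimension [n] for the sections at [t], [u] and [p * t + q * u]
    is the hypothesis of the one-dimensional inequality for the integrals of sections. *)
Lemma prekopa_leindler n (p q : R) (F G H : 'rV[R]_n -> \bar R) :
  0 < p -> 0 < q -> p + q = 1 ->
  measurable_fun setT (F \o @coord_rV R n) ->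
  measurable_fun setT (G \o @coord_rV R n) ->
  measurable_fun setT (H \o @coord_rV R n) ->
  (forall x, 0 <= F x)%E -> (forall x, 0 <= G x)%E -> (forall x, 0 <= H x)%E ->
  (forall x y, F x `^ p * G y `^ q <= H (p *: x + q *: y)%R)%E ->
  ((\int[coord_measure R n]_x F (coord_rV x)) `^ p *
   (\int[coord_measure R n]_x G (coord_rV x)) `^ q <=
   \int[coord_measure R n]_x H (coord_rV x))%E.
Proof.
move=> p0 q0 pq; elim: n F G H => [|n IH] F G H mF mG mH F0 G0 H0 FGH.
  by rewrite !integral_rV0; have := FGH 0 0; rewrite !scaler0 addr0.
rewrite !integral_rV_recl//.
apply: prekopa_leindler1 => //; try exact: measurable_rV_integral.
- by move=> t; exact: integral_ge0.
- by move=> t; exact: integral_ge0.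
- by move=> t; exact: integral_ge0.
move=> t u; apply: (IH (fun y => F (row_mx t%:M y)) (fun y => G (row_mx u%:M y))
    (fun y => H (row_mx (p * t + q * u)%:M y))) => //;
  try exact: measurable_rV_section.
by move=> x y; rewrite row_mx_linear; exact: FGH.
Qed.

(** Measurability on R^n is expressed through [coord_rV], so affine maps have to be lifted to
    [coord R n]. *)
Lemma coord_affine n (a : R) (v : 'rV[R]_n) :
  exists2 T : coord R n -> coord R n, measurable_fun setT T &
    forall x, coord_rV (T x) = a *: coord_rV x + v.
Proof.
elim: n v => [|n IH] v.
  by exists id => // x; apply/rowP => -[].
have [T mT TE] := IH (@rsubmx _ 1 1 n v).
exists (fun x => (a * x.1 + v 0 0, T x.2)).
  apply: measurable_fun_pair; last first.
    by apply: measurableT_comp => //; exact: measurable_snd.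
  apply: measurable_funD => //; apply: measurable_funM => //; exact: measurable_fst.
by move=> x /=; rewrite TE row_mx_affine.
Qed.

Lemma measurable_rV_affine d (U : measurableType d) n (f : 'rV[R]_n -> U)
    (a : R) (v : 'rV[R]_n) :
  measurable_fun setT (f \o @coord_rV R n) ->
  measurable_fun setT ((fun x => f (a *: x + v)) \o @coord_rV R n).
Proof.
move=> mf; have [T mT TE] := coord_affine a v.
rewrite (_ : _ \o _ = (f \o @coord_rV R n) \o T); first exact: measurableT_comp.
by apply/funext => x /=; rewrite TE.
Qed.

Lemma integral_rV_affine n (a : R) (v : 'rV[R]_n) (f : 'rV[R]_n -> \bar R) :
  0 < a -> measurable_fun setT (f \o @coord_rV R n) -> (forall x, 0 <= f x)%E ->
  (\int[coord_measure R n]_x f (a *: coord_rV x + v)%R =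
   (a ^- n)%:E * \int[coord_measure R n]_x f (coord_rV x))%E.
Proof.
move=> a0; elim: n v f => [|n IH] v f mf f0.
  rewrite (integral_rV0 (fun x => f (a *: x + v))) integral_rV0.
  by rewrite expr0 invr1 mul1e; congr f; apply/rowP; case.
have mf' := measurable_rV_affine a v mf.
rewrite (integral_rV_recl mf' (fun=> f0 _)) (integral_rV_recl mf f0).
have step t : (\int[coord_measure R n]_y f (a *: row_mx t%:M (coord_rV y) + v)%R =
    (a ^- n)%:E * \int[coord_measure R n]_y
      f (row_mx (a * t + v 0 0)%:M (coord_rV y))%R)%E.
  under eq_integral do rewrite row_mx_affine.
  rewrite (IH _ (fun y => f (row_mx (a * t + v 0 0)%:M y)))//.
  exact: measurable_rV_section.
under eq_integral do rewrite step.
pose g t := (\int[coord_measure R n]_y f (row_mx t%:M (coord_rV y)))%E.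
have mg : measurable_fun setT g := measurable_rV_integral mf f0.
have g0 t : (0 <= g t)%E by exact: integral_ge0.
suff : (\int[lebesgue_measure]_t ((a ^- n)%:E * g (a * t + v 0 0)%R) =
  (a ^- n.+1)%:E * \int[lebesgue_measure]_t g t)%E by [].
clear step; clearbody g.
have mga : measurable_fun setT (fun t : R => g (a * t + v 0 0)).
  by apply: measurableT_comp => //; apply: measurable_funD.
rewrite ge0_integralZl//; last by rewrite lee_fin invr_ge0 exprn_ge0 ?ltW.
rewrite [X in (_ * X)%E](integral_affine (v 0 0) a0 mg g0) muleA -EFinM.
congr (_%:E * _)%E.
by rewrite exprSr invfM.
Qed.

End coord.

(** * Euclidean distance to a compact set *)

Section euclidean.
Context (R : realType) (n : nat).
Implicit Types x y v : 'rV[R]_n.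
Local Notation norm := (@euclidean_norm R n).

Lemma sqr_euclidean_norm x : norm x ^+ 2 = \sum_(i < n) x 0 i ^+ 2.
Proof. by rewrite sqr_sqrtr// sumr_ge0// => i _; exact: sqr_ge0. Qed.

Lemma euclidean_norm_ge0 x : 0 <= norm x.
Proof. exact: sqrtr_ge0. Qed.

Lemma euclidean_normZ a x : norm (a *: x) = `|a| * norm x.
Proof.
rewrite /euclidean_norm -sqrtr_sqr -sqrtrM ?sqr_ge0// mulr_sumr.
by congr Num.sqrt; apply: eq_bigr => i _; rewrite mxE exprMn.
Qed.

Lemma euclidean_normN x : norm (- x) = norm x.
Proof. by rewrite -scaleN1r euclidean_normZ normrN1 mul1r. Qed.

Lemma euclidean_norm0_eq0 x : norm x = 0 -> x = 0.
Proof.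
move=> x0; apply/rowP => i; rewrite mxE; apply/eqP; rewrite -sqrf_eq0.
have := sqr_euclidean_norm x; rewrite x0 expr0n/= => /esym/eqP.
by rewrite psumr_eq0 => [/allP/(_ i (mem_index_enum _))//|j _]; exact: sqr_ge0.
Qed.

Lemma sqr_norm_convex p q x y : 0 <= p -> 0 <= q -> p + q = 1 ->
  norm (p *: x + q *: y) ^+ 2 <= p * norm x ^+ 2 + q * norm y ^+ 2.
Proof.
move=> p0 q0 pq; rewrite !sqr_euclidean_norm !mulr_sumr -big_split/=.
apply: ler_sum => i _; rewrite !mxE.
rewrite -subr_ge0 (_ : _ - _ = p * q * (x 0 i - y 0 i) ^+ 2).
  by apply: mulr_ge0; [exact: mulr_ge0|exact: sqr_ge0].
have -> : q = 1 - p by lra.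
ring.
Qed.

(* Convexity of the square applied to [x / p] and [y / q], with [p] and [q]
   proportional to the norms of [x] and [y]. *)
Lemma euclidean_norm_triangle x y : norm (x + y) <= norm x + norm y.
Proof.
have [x0|xn0] := eqVneq (norm x) 0.
  by rewrite x0 (euclidean_norm0_eq0 x0) !add0r.
have [y0|yn0] := eqVneq (norm y) 0.
  by rewrite y0 (euclidean_norm0_eq0 y0) !addr0.
have x_gt0 : 0 < norm x by rewrite lt_neqAle eq_sym xn0 euclidean_norm_ge0.
have y_gt0 : 0 < norm y by rewrite lt_neqAle eq_sym yn0 euclidean_norm_ge0.
set s := norm x + norm y; have s0 : 0 < s by rewrite addr_gt0.
rewrite -ler_sqr ?nnegrE ?euclidean_norm_ge0 ?(ltW s0)//.
have := @sqr_norm_convex (norm x / s) (norm y / s) ((s / norm x) *: x)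
  ((s / norm y) *: y).
rewrite !divr_ge0 ?euclidean_norm_ge0 ?(ltW s0)// -mulrDl divff ?gt_eqF//.
rewrite !scalerA !(mulrA (_ / s)) !divfK ?gt_eqF// !divff// !scale1r.
move=> /(_ erefl erefl erefl) /le_trans; apply.
rewrite !euclidean_normZ !ger0_norm ?divr_ge0 ?euclidean_norm_ge0 ?(ltW s0)//.
rewrite [leLHS](_ : _ = s ^+ 2) ?lexx// /s; field.
by rewrite xn0 yn0 /= gt_eqF.
Qed.

End euclidean.

Lemma measurable_coord (R : realType) n (i : 'I_n) :
  measurable_fun setT (fun x : coord R n => coord_rV x 0 i).
Proof.
elim: n i => [|n IH] i; first by have := ltn_ord i.
rewrite -[i](@splitK 1 n); case: (fintype.split _) => j /=.
- rewrite (_ : (fun _ => _) = fst); first exact: measurable_fst.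
  apply/funext => x /=; rewrite (row_mxEl (x.1%:M : 'rV_1) (coord_rV x.2) 0 j).
  by rewrite mxE ord1 mulr1n.
- rewrite (_ : (fun _ => _) = (fun y => coord_rV y 0 j) \o snd).
    by apply: measurableT_comp => //; exact: measurable_snd.
  by apply/funext => x /=; rewrite (row_mxEr (x.1%:M : 'rV_1) (coord_rV x.2) 0 j).
Qed.

Lemma measurable_euclidean_norm (R : realType) n (v : 'rV[R]_n) :
  measurable_fun setT ((fun x => euclidean_norm (x - v)) \o @coord_rV R n).
Proof.
apply: (@measurableT_comp _ _ _ _ _ _ (@Num.sqrt R)).
  by apply: continuous_measurable_fun => x; exact: sqrt_continuous.
apply: measurable_sum => i; apply: measurable_funX.
rewrite (_ : (fun _ => _) = (fun x => coord_rV x 0 i + - v 0 i)); last first.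
  by apply/funext => x; rewrite !mxE.
by apply: measurable_funD => //; exact: measurable_coord.
Qed.

Lemma rat_rV_dense (R : realType) n (x : 'rV[R]_n) (e : R) : 0 < e ->
  exists q : 'rV[rat]_n, euclidean_norm (x - map_mx ratr q) < e.
Proof.
(* An error below [d] in each coordinate suffices because [n < (n + 1)^2]; the successor also covers
   [n = 0]. *)
move=> e0; pose d := e / n.+1%:R.
have d0 : 0 < d by rewrite divr_gt0.
have /choice[q qx] : forall i, exists q : rat, `|x 0 i - ratr q| < d.
  move=> i; have [|q] := @rat_in_itvoo R (x 0 i - d) (x 0 i + d); first lra.
  rewrite in_itv /= => /andP[? ?]; exists q.
  by rewrite ltr_distlC; apply/andP; split; lra.
exists (\row_i q i).
rewrite -ltr_sqr ?nnegrE ?euclidean_norm_ge0 ?(ltW e0)// sqr_euclidean_norm.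
apply: (@le_lt_trans _ _ (\sum_(i < n) d ^+ 2)).
  apply: ler_sum => i _; rewrite !mxE -[leLHS]ger0_norm ?sqr_ge0// normrX.
  rewrite ler_sqr ?nnegrE ?(ltW d0)//.
  exact: ltW.
rewrite sumr_const card_ord -[ltLHS]mulr_natl /d expr_div_n.
rewrite mulrCA gtr_pMr ?exprn_gt0// ltr_pdivrMr ?exprn_gt0// mul1r.
by rewrite -natrX ltr_nat (@leq_trans n.+1)// -{1}[n.+1]expn1 leq_pexp2l.
Qed.

(** Each strict sublevel set is a countable union of balls with rational centres: [g x < a] as soon
    as [g q + |x - q| < a], and conversely a [q] closer to [x] than half the gap [a - g x] works. *)
Lemma measurable_lipschitz (R : realType) n (g : 'rV[R]_n -> R) :
  (forall x y, g x <= g y + euclidean_norm (x - y)) ->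
  measurable_fun setT (g \o @coord_rV R n).
Proof.
move=> glip; apply: (measurability _ (RGenInftyO.measurableE R)) => //.
move=> _ [_ [a ->] <-]; rewrite setTI.
rewrite (_ : _ @^-1` _ = \bigcup_(q in [set: 'rV[rat]_n])
  [set x | g (map_mx ratr q) + euclidean_norm (coord_rV x - map_mx ratr q) < a]).
  apply: countable_bigcupT_measurable => // q.
  rewrite -[X in measurable X]setTI.
  have mh : measurable_fun setT (fun x : coord R n =>
      g (map_mx ratr q) + euclidean_norm (coord_rV x - map_mx ratr q)).
    by apply: measurable_funD => //; exact: measurable_euclidean_norm.
  have := mh measurableT `]-oo, a[%classic (measurable_itv _).
  by congr measurable; apply/seteqP; split => x /=; rewrite in_itv.
apply/seteqP; split => x /=; rewrite in_itv /=.
- move=> ga; have [|q qx] := @rat_rV_dense R n (coord_rV x) ((a - g (coord_rV x)) / 2).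
    lra.
  exists q => //=; have := glip (map_mx ratr q) (coord_rV x).
  rewrite -(opprB (coord_rV x)) euclidean_normN; lra.
- by case=> q _ /=; apply: le_lt_trans.
Qed.

Lemma continuous_euclidean_norm (R : realType) n :
  continuous (@euclidean_norm R n).
Proof.
move=> x; apply: (@continuous_comp _ _ _ _ (@Num.sqrt R)); last exact: sqrt_continuous.
have addc : continuous (fun z : R * R => z.1 + z.2) by exact: add_continuous.
apply: (@continuous_big R 'I_n +%R 0 xpredT addc 'rV[R]_n (index_enum 'I_n)
  (fun i (x : 'rV[R]_n) => x 0 i ^+ 2)).
move=> i _ y; apply: (@continuous_comp _ _ _ (fun y : 'rV[R]_n => y 0 i) (fun t => t ^+ 2)).
  exact: coord_continuous.
exact: exprn_continuous.
Qed.

Definition infdist (R : realType) n (K : set 'rV[R]_n) (x : 'rV[R]_n) : R :=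
  inf [set euclidean_norm (x - k) | k in K].

Section infdist.
Context (R : realType) (n : nat) (K : set 'rV[R]_n).
Hypotheses (K0 : K !=set0) (cK : compact K).
Implicit Types x y : 'rV[R]_n.

Lemma infdist_le x k : K k -> infdist K x <= euclidean_norm (x - k).
Proof.
move=> Kk; apply: ge_inf; last by exists k.
by exists 0 => _ [y _ <-]; exact: euclidean_norm_ge0.
Qed.

Lemma infdist_ge0 x : 0 <= infdist K x.
Proof.
case: K0 => k Kk; apply: lb_le_inf; first by exists (euclidean_norm (x - k)), k.
by move=> _ [y _ <-]; exact: euclidean_norm_ge0.
Qed.

Lemma infdist_attained x :
  exists2 k, K k & infdist K x = euclidean_norm (x - k).
Proof.
have [|k /set_mem Kk kmin] :=
    @compact_EVT_min _ R (fun k : 'rV[R]_n => euclidean_norm (x - k)) K K0 cK.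
  apply: continuous_subspaceT => k.
  apply: (@continuous_comp _ _ _ (fun k : 'rV[R]_n => x - k) (@euclidean_norm R n)).
    by apply: continuousB => //; exact: cst_continuous.
  exact: continuous_euclidean_norm.
exists k => //; apply/eqP; rewrite eq_le infdist_le//=.
apply: lb_le_inf; first by exists (euclidean_norm (x - k)), k.
by move=> _ [y Ky <-]; apply: kmin; rewrite inE.
Qed.

Lemma infdist_lipschitz x y : infdist K x <= infdist K y + euclidean_norm (x - y).
Proof.
have [k Kk ->] := infdist_attained y.
apply: (le_trans (infdist_le x Kk)); rewrite [leRHS]addrC.
by have := euclidean_norm_triangle (x - y) (y - k); rewrite addrA subrK.
Qed.

(** Turns the parallel bodies of the Steiner formula into sublevel sets of the distance. *)
Lemma infdist_sublevel r : 0 <= r ->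
  minkowski_sum K (dilation r (@euclidean_unit_ball R n)) =
  [set x | infdist K x <= r].
Proof.
move=> r0; apply/seteqP; split => x /=.
- case=> k Kk [_ [b b1 <-] <-]; apply: (le_trans (infdist_le _ Kk)).
  by rewrite addrC addKr euclidean_normZ ger0_norm// ler_piMr.
- have [k Kk ->] := infdist_attained x => xk.
  (* The ball point is obtained by dividing [x - k] by [r]; for [r = 0] one has [x = k] instead. *)
  have [r_eq0|r_neq0] := eqVneq r 0.
    exists k => //; exists 0.
      exists 0; last by rewrite scaler0.
      rewrite /euclidean_unit_ball /= -(scale0r (0 : 'rV_n)) euclidean_normZ.
      by rewrite normr0 mul0r.
    apply/esym/eqP; rewrite addr0 -subr_eq0; apply/eqP/euclidean_norm0_eq0/eqP.
    by rewrite eq_le euclidean_norm_ge0 -r_eq0 xk.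
  exists k => //; exists (x - k); last by rewrite addrC subrK.
  exists (r^-1 *: (x - k)); last by rewrite scalerA divff ?scale1r.
  rewrite /euclidean_unit_ball /= euclidean_normZ ger0_norm ?invr_ge0//.
  by rewrite ler_pdivrMl ?mulr1// lt_neqAle eq_sym r_neq0.
Qed.

Lemma measurable_infdist : measurable_fun setT (infdist K \o @coord_rV R n).
Proof. by apply: measurable_lipschitz; exact: infdist_lipschitz. Qed.

End infdist.

Lemma row_mx_norm (R : realType) n (t : R) (y : 'rV[R]_n) :
  euclidean_norm (row_mx (t%:M : 'rV_1) y) ^+ 2 = t ^+ 2 + euclidean_norm y ^+ 2.
Proof.
rewrite !sqr_euclidean_norm big_split_ord /= big_ord1 row_mxEl mxE mulr1n.
by congr (_ + _); apply: eq_bigr => i _; rewrite row_mxEr.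
Qed.

(** * Gaussian integrals *)

Lemma integral_gauss1 (R : realType) :
  (\int[lebesgue_measure]_t (expR (- pi * t ^+ 2))%:E = 1 :> \bar R)%E.
Proof.
pose g (x : R) : \bar R := (gauss_fun x)%:E.
have mg : measurable_fun setT g.
  by apply/measurable_EFinP; exact: measurable_gauss_fun.
have pi0 : 0 < Num.sqrt (pi : R) by rewrite sqrtr_gt0 pi_gt0.
have := @integral_affine R (Num.sqrt pi) 0 g pi0 mg.
rewrite (_ : (\int[lebesgue_measure]_x g x)%E = (Num.sqrt pi)%:E); last first.
  exact: integralT_gauss.
rewrite -EFinM mulVf ?gt_eqF// => <-; last first.
  by move=> x; rewrite lee_fin gauss_fun_ge0.
apply: eq_integral => t _; rewrite /g /gauss_fun addr0 exprMn sqr_sqrtr ?pi_ge0//.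
by rewrite mulNr.
Qed.

Lemma integral_gauss (R : realType) n (v : 'rV[R]_n) :
  (\int[coord_measure R n]_x
     (expR (- pi * euclidean_norm (coord_rV x - v) ^+ 2))%:E = 1)%E.
Proof.
pose f m : 'rV[R]_m -> \bar R := fun x => (expR (- pi * euclidean_norm x ^+ 2))%:E.
have mf m : measurable_fun setT (f m \o @coord_rV R m).
  apply/measurable_EFinP; apply: measurableT_comp => //.
  apply: measurable_funM => //; apply: measurable_funX.
  have := measurable_euclidean_norm (0 : 'rV[R]_m).
  by congr measurable_fun; apply/funext => x /=; rewrite subr0.
have f0 m x : (0 <= f m x)%E by rewrite lee_fin expR_ge0.
have := @integral_rV_affine R n 1 (- v) (f n) ltr01 (mf n) (f0 n).
rewrite expr1n invr1 mul1e.
under eq_integral do rewrite scale1r.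
move=> ->; elim: n {v} => [|n IH].
  rewrite integral_rV0 /f sqr_euclidean_norm big_ord0 mulr0 expR0; exact: erefl.
rewrite integral_rV_recl// -(integral_gauss1 R); apply: eq_integral => t _.
rewrite -[RHS]mule1 -IH -ge0_integralZl//.
by apply: eq_integral => y _; rewrite /f row_mx_norm mulrDr expRD EFinM.
Qed.

(** * From the Steiner polynomial to Gaussian integrals *)

Lemma measurable_sublevel d (T : measurableType d) (R : realType) (g : T -> R)
    (r : R) : measurable_fun setT g -> measurable [set x | g x <= r].
Proof.
move=> mg; have := mg measurableT `]-oo, r]%classic (measurable_itv _).
congr measurable; apply/seteqP; split => x /=; rewrite in_itv /=; first by case.
by move=> ?; split.
Qed.

Section wills_functional.
Context (R : realType).

Lemma coord_measure_scale n (a : R) (A : set 'rV[R]_n) : 0 < a ->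
  measurable (@coord_rV R n @^-1` A) ->
  coord_measure R n [set x | A (a *: coord_rV x)] =
  ((a ^- n)%:E * coord_measure R n (@coord_rV R n @^-1` A))%E.
Proof.
move=> a0 mA.
pose f (x : 'rV[R]_n) : \bar R := (\1_A x)%:E.
have mf : measurable_fun setT (f \o @coord_rV R n).
  have := measurable_indic mA : measurable_fun setT (\1_(@coord_rV R n @^-1` A) : _ -> R).
  by move=> m1; apply/measurable_EFinP; exact: m1.
have f0 x : (0 <= f x)%E by rewrite lee_fin.
have [T mT TE] := coord_affine a (0 : 'rV[R]_n).
have mAa : measurable [set x | A (a *: @coord_rV R n x)].
  have := mT measurableT _ mA; congr measurable.
  apply/seteqP; split => x /=; rewrite TE addr0; first by case.
  by move=> Ax; split.
have measureE (B : set (coord R n)) : measurable B ->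
    coord_measure R n B = (\int[coord_measure R n]_x (\1_B x)%:E)%E.
  by move=> mB; rewrite integral_indic// setIT.
rewrite !measureE//; have := integral_rV_affine 0 a0 mf f0.
by under eq_integral do rewrite addr0.
Qed.

Let ball n (r : R) : set (coord R n) :=
  [set x | euclidean_norm (coord_rV x) <= r].

Let mball n r : measurable (@ball n r).
Proof.
apply: measurable_sublevel.
have := measurable_euclidean_norm (0 : 'rV[R]_n).
by congr measurable_fun; apply/funext => x /=; rewrite subr0.
Qed.

(** The indicator of the unit ball is at most [expR pi] times the Gaussian. Finiteness makes the
    [fine] in [kappa] faithful. *)
Lemma coord_measure_ball_lty n : (coord_measure R n (ball 1) < +oo)%E.
Proof.
have mg : measurable_fun setT (fun x : coord R n =>
    (expR (- pi * euclidean_norm (coord_rV x - 0) ^+ 2))%:E : \bar R).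
  apply/measurable_EFinP; apply: measurableT_comp => //.
  apply: measurable_funM => //; apply: measurable_funX.
  exact: measurable_euclidean_norm.
rewrite -(setIT (ball 1)) -integral_indic//.
apply: (@le_lt_trans _ _ ((expR pi)%:E * \int[coord_measure R n]_x
    (expR (- pi * euclidean_norm (coord_rV x - 0) ^+ 2))%:E)%E); last first.
  by rewrite integral_gauss mule1 ltry.
rewrite -ge0_integralZl//.
apply: ge0_le_integral => //.
- by apply/measurable_EFinP; exact: measurable_indic.
- exact: measurable_funeM.
move=> x _; rewrite -EFinM lee_fin -expRD indicE.
case: (boolP (x \in ball 1)) => [/set_mem|_]; last exact: expR_ge0.
rewrite /ball /= => x1; rewrite subr0 -(expR0) ler_expR -[X in X + _]mulr1 mulNr -mulrBr.
by rewrite mulr_ge0 ?pi_ge0// subr_ge0 expr_le1 ?euclidean_norm_ge0.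
Qed.

Lemma coord_measure_ball n r : 0 <= r ->
  coord_measure R n [set x | euclidean_norm (coord_rV x) <= r] =
  (kappa R n * r ^+ n)%:E.
Proof.
have k1 : coord_measure R n (ball 1) = (kappa R n)%:E.
  rewrite /kappa vol_coord_measure fineK// ge0_fin_numE//.
  exact: coord_measure_ball_lty.
rewrite le_eqVlt => /predU1P[<-|r0]; last first.
  have rn0 : r^-1 != 0 by rewrite invr_neq0// gt_eqF.
  have := @coord_measure_scale n r^-1 [set x | euclidean_norm x <= 1].
  rewrite invr_gt0 => /(_ r0 (@mball n 1)); rewrite -/(ball 1) k1 -exprVn invrK.
  rewrite -EFinM mulrC => <-; congr (coord_measure R n _).
  apply/seteqP; split => x /=; rewrite euclidean_normZ ger0_norm ?invr_ge0 ?(ltW r0)//;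
  by rewrite ler_pdivrMl// mulr1.
(* Radius 0. In dimension 0 the ball is the whole space and the power is 1. Otherwise [ball 0] is
   invariant under scaling by 2, so its finite measure equals a proper fraction of itself. *)
case: n k1 => [|n] k1.
  rewrite expr0 mulr1 -k1; congr (coord_measure R 0 _).
  by apply/seteqP; split => x _ /=; rewrite /ball /= /euclidean_norm big_ord0 sqrtr0.
rewrite expr0n mulr0 /=.
have fin0 : coord_measure R n.+1 (ball 0) \is a fin_num.
  rewrite ge0_fin_numE//; apply: le_lt_trans (coord_measure_ball_lty n.+1).
  by apply: le_measure; rewrite ?inE// => x /= /le_trans; apply.
have := @coord_measure_scale n.+1 2 [set x | euclidean_norm x <= 0].
move=> /(_ ltac:(done) (@mball n.+1 0)).
rewrite (_ : [set x | _] = ball 0); last first.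
  by apply/seteqP; split => x /=; rewrite /ball /= euclidean_normZ ger0_norm// pmulr_rle0.
change (coord_measure R n.+1 (ball 0) =
  (2 ^- n.+1)%:E * coord_measure R n.+1 (ball 0) -> coord_measure R n.+1 (ball 0) = 0)%E.
rewrite -(fineK fin0) -EFinM => -[E].
have {}E : (1 - 2 ^- n.+1) * fine (coord_measure R n.+1 (ball 0)) = 0.
  by rewrite mulrBl mul1r -E subrr.
have lt1 : (2 ^- n.+1 : R) < 1 by rewrite invf_lt1 ?exprn_gt0// exprn_egt1 ?ltr1n.
move/eqP : E; rewrite mulf_eq0 subr_eq0 eq_sym (lt_eqF lt1) /=.
by move=> /eqP ->.
Qed.

(* For [0 < c <= 1], the radius at which [expR (- pi * r ^+ 2)] equals [c]. *)
Let gauss_radius (c : R) : R := Num.sqrt (- ln c / pi).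

(** What a term [r ^+ j] in the measure of the sublevel sets contributes at level [c]; only levels
    in ]0, 1] are reached by the Gaussian. *)
Let weight (j : nat) (c : R) : R := (0 < c <= 1)%R%:R * gauss_radius c ^+ j.

Let weight_ge0 j c : 0 <= weight j c.
Proof. by rewrite mulr_ge0 ?exprn_ge0 ?sqrtr_ge0. Qed.

Let measurable_weight j : measurable_fun setT (weight j).
Proof.
apply: measurable_funM.
  rewrite (_ : (fun _ => _) = \1_(`]0, 1]%classic : set R)).
    by apply: measurable_indic; exact: measurable_itv.
  by apply/funext => c; rewrite indicE mem_setE in_itv.
apply: measurable_funX.
apply: (@measurableT_comp _ _ _ _ _ _ (@Num.sqrt R)).
  by apply: continuous_measurable_fun => x; exact: sqrt_continuous.
apply: measurable_funM => //.
by apply: measurable_funN; exact: measurable_ln.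
Qed.

(** Layer cake: at a level [c] in ]0, 1] the superlevel set of the integrand is the sublevel set of
    [D] at [gauss_radius c]. *)
Lemma integral_gauss_sublevel d (T : measurableType d)
    (mu : {sigma_finite_measure set T -> \bar R}) (D : T -> R) (v : R -> R) :
  measurable_fun setT D -> (forall x, 0 <= D x) ->
  (forall r, 0 <= r -> mu [set x | D x <= r] = (v r)%:E) ->
  (\int[mu]_x (expR (- pi * D x ^+ 2))%:E =
   \int[lebesgue_measure]_c ((0 < c <= 1)%R%:R * v (gauss_radius c))%:E)%E.
Proof.
move=> mD D0 Dv.
have mf : measurable_fun setT (fun x => expR (- pi * D x ^+ 2)).
  by apply: measurableT_comp => //; apply: measurable_funM => //; exact: measurable_funX.
rewrite (layer_cake mu mf) => [|x]; last exact: expR_ge0.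
apply: eq_integral => c _.
have [/andP[c0 c1]|c01] := boolP (0 < c <= 1); last first.
  rewrite mul0r (_ : [set x | _] = set0) ?measure0//.
  apply/seteqP; split => x //= /andP[c0 ch]; case/negP: c01.
  rewrite c0 (le_trans ch)// -expR0 ler_expR mulNr oppr_le0.
  by rewrite mulr_ge0 ?pi_ge0 ?sqr_ge0.
have key x : (c <= expR (- pi * D x ^+ 2)) = (D x <= gauss_radius c).
  have q0 : 0 <= - ln c / pi by rewrite divr_ge0 ?pi_ge0// oppr_ge0 ln_le0.
  rewrite -[leLHS](@lnK _ c) ?posrE// ler_expR mulNr lerNr mulrC -ler_pdivlMr ?pi_gt0//.
  by rewrite -[leRHS](sqr_sqrtr q0) ler_sqr ?nnegrE ?sqrtr_ge0.
rewrite mul1r -Dv ?sqrtr_ge0//; congr (mu _).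
by apply/seteqP; split => x /=; rewrite c0 key.
Qed.

(* The normalisation of the Gaussian on R^j, by layers. *)
Lemma kappa_weight j :
  (\int[lebesgue_measure]_c (weight j c)%:E = ((kappa R j)^-1)%:E)%E /\
  kappa R j != 0.
Proof.
have mD : measurable_fun setT (@euclidean_norm R j \o @coord_rV R j).
  have := measurable_euclidean_norm (0 : 'rV[R]_j).
  by congr measurable_fun; apply/funext => x /=; rewrite subr0.
have k0 : 0 <= kappa R j.
  have := @coord_measure_ball j 1 ler01; rewrite expr1n mulr1 => k1.
  by rewrite -lee_fin -k1 measure_ge0.
have := @integral_gauss_sublevel _ _ (coord_measure R j) _ (fun r => kappa R j * r ^+ j)
  mD (fun=> euclidean_norm_ge0 _) (@coord_measure_ball j).
have := integral_gauss (0 : 'rV[R]_j).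
under eq_integral do rewrite subr0.
move=> /= -> E.
(* This identity yields both the value of the integral and [kappa R j != 0]. *)
have {}E : (1 = (kappa R j)%:E * \int[lebesgue_measure]_c (weight j c)%:E)%E.
  rewrite -ge0_integralZl//.
  - by rewrite E; apply: eq_integral => c _; rewrite -EFinM /weight mulrCA.
  - by apply/measurable_EFinP; exact: measurable_weight.
  - by move=> c _; rewrite lee_fin weight_ge0.
have kn0 : kappa R j != 0.
  by apply/eqP => kj; move: E; rewrite kj mul0e => -[] /eqP; rewrite oner_eq0.
split => //.
rewrite -[LHS]mul1e -(mulVf kn0) EFinM -muleA -E mule1.
exact: erefl.
Qed.

Lemma integral_gauss_polynomial n (D : coord R n -> R) (b : nat -> R) :
  measurable_fun setT D -> (forall x, 0 <= D x) ->
  (forall r, 0 <= r -> coord_measure R n [set x | D x <= r] =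
     (\sum_(i < n.+1) kappa R (n - i) * b i * r ^+ (n - i))%:E) ->
  (\int[coord_measure R n]_x (expR (- pi * D x ^+ 2))%:E =
   (\sum_(i < n.+1) b i)%:E)%E.
Proof.
move=> mD D0 DV; rewrite (integral_gauss_sublevel mD D0 DV).
(* The coefficients [b i] may have any sign, so the integral is split by integrability rather than
   by positivity. *)
have iw j : (@lebesgue_measure R).-integrable setT (EFin \o weight j).
  apply/integrableP; split.
    by apply/measurable_EFinP; exact: measurable_weight.
  under eq_integral do rewrite /= ger0_norm ?weight_ge0//.
  by have [-> _] := kappa_weight j; rewrite ltry.
transitivity (\int[lebesgue_measure]_c \sum_(i < n.+1)
    (kappa R (n - i) * b i)%:E * (weight (n - i) c)%:E)%E.
  apply: eq_integral => c _; rewrite mulr_sumr -sumEFin.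
  by apply: eq_bigr => i _; rewrite -EFinM /weight mulrCA.
rewrite integral_sum//; last first.
  by move=> i; apply: integrableZl => //; exact: iw.
rewrite -sumEFin; apply: eq_bigr => i _.
have [kw kn0] := kappa_weight (n - i).
by rewrite (integralZl measurableT (iw _)) [X in (_ * X)%E]kw -EFinM mulrAC divff ?mul1r.
Qed.

End wills_functional.

(** * The two bounds *)

Lemma poly_ge0_at0 (R : realType) (p : {poly R}) :
  (forall s, 0 < s < 1 -> 0 <= p.[s]) -> 0 <= p.[0].
Proof.
move=> p_ge0; rewrite leNgt; apply/negP => p0_lt0.
have : \forall s \near (0 : R), p.[s] < 0.
  exact: (@cvgr_lt R R (nbhs (0 : R)) _ (horner p : R -> R) p.[0]
    (@continuous_horner R p 0) _ p0_lt0).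
move=> /nbhs_ballP[e /= e0 ep].
pose s := Num.min e 1 / 2.
have s0 : 0 < s by rewrite divr_gt0// lt_min e0 ltr01.
have es : s < Num.min e 1 by rewrite ltr_pdivrMr// mulr_natr mulr2n ltrDl lt_min e0 ltr01.
move: es; rewrite lt_min => /andP[se s1].
have := p_ge0 s; rewrite s0 s1 => /(_ erefl); rewrite leNgt; apply/negP/negPn.
by apply: ep; rewrite /ball /= sub0r normrN gtr0_norm.
Qed.

(** The quotient of [p] by the indeterminate is still nonnegative on ]0, 1[, and its value at 0 is
    the coefficient sought. *)
Lemma poly_ge0_coef1 (R : realType) (p : {poly R}) :
  (forall s, 0 < s < 1 -> 0 <= p.[s]) -> p`_0 = 0 -> 0 <= p`_1.
Proof.
move=> pge0 p0; have [q pE] : exists q, p = q * 'X.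
  have /factor_theorem[q ->] : root p 0 by rewrite rootE horner_coef0 p0.
  by exists q; rewrite subr0.
rewrite pE coefMX /= -horner_coef0; apply: poly_ge0_at0 => s /[dup] /pge0.
by rewrite pE hornerM hornerX => + /andP[s0 _]; rewrite pmulr_lge0.
Qed.

Section wills_inequalities.
Context (R : realType) (n : nat) (K : set 'rV[R]_n) (V : nat -> R).
Hypotheses (K0 : K !=set0) (cK : compact K) (VK : intrinsic_volumes K V).

Let wills_poly (s : R) : R := \sum_(i < n.+1) V i * s ^+ i.

Let measurable_dist s :
  measurable_fun setT (fun x => s * infdist K (s^-1 *: @coord_rV R n x)).
Proof.
apply: measurable_funM => //.
have := measurable_rV_affine s^-1 0 (measurable_infdist K0 cK).
by congr measurable_fun; apply/funext => x /=; rewrite addr0.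
Qed.

Let measurable_gauss_dist s : measurable_fun setT (fun x : coord R n =>
  (expR (- pi * (s * infdist K (s^-1 *: coord_rV x)) ^+ 2))%:E : \bar R).
Proof.
apply/measurable_EFinP; apply: measurableT_comp => //.
apply: measurable_funM => //; exact: measurable_funX.
Qed.

(** The sublevel set at [r] is [s] times the parallel body at [r / s], and
    [s ^+ n * (r / s) ^+ (n - i)] is [s ^+ i * r ^+ (n - i)]. *)
Lemma integral_wills_poly s : 0 < s ->
  (\int[coord_measure R n]_x
     (expR (- pi * (s * infdist K (s^-1 *: coord_rV x)) ^+ 2))%:E =
   (wills_poly s)%:E)%E.
Proof.
move=> s0; apply: (@integral_gauss_polynomial R n _ (fun i => V i * s ^+ i)) => //.
  by move=> x; rewrite mulr_ge0 ?(ltW s0)// infdist_ge0.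
move=> r r0; have rs0 : 0 <= r / s by rewrite divr_ge0 ?(ltW s0).
have -> : [set x | s * infdist K (s^-1 *: @coord_rV R n x) <= r] =
    [set x | [set y | infdist K y <= r / s] (s^-1 *: @coord_rV R n x)].
  by apply/seteqP; split => x /=; rewrite ler_pdivlMr// mulrC.
rewrite coord_measure_scale ?invr_gt0//; last first.
  exact: (measurable_sublevel (r / s) (measurable_infdist K0 cK)).
rewrite -infdist_sublevel// -vol_coord_measure VK// -EFinM -exprVn invrK mulr_sumr.
congr EFin; apply: eq_bigr => i _.
have -> : s ^+ n = s ^+ i * s ^+ (n - i) by rewrite -exprD subnKC// -ltnS.
rewrite expr_div_n; field; by rewrite expf_neq0 ?gt_eqF.
Qed.

Let wills1 : wills_poly 1 = wills n V.
Proof. by apply: eq_bigr => i _; rewrite expr1n mulr1. Qed.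

Lemma integral_wills : (\int[coord_measure R n]_x
  (expR (- pi * infdist K (coord_rV x) ^+ 2))%:E = (wills n V)%:E)%E.
Proof.
rewrite -wills1 -(integral_wills_poly ltr01); apply: eq_integral => x _.
by rewrite invr1 scale1r mul1r.
Qed.

Let measurable_gauss_dist1 : measurable_fun setT (fun x : coord R n =>
  (expR (- pi * infdist K (coord_rV x) ^+ 2))%:E : \bar R).
Proof.
have := measurable_gauss_dist 1; congr measurable_fun.
by apply/funext => x; rewrite invr1 scale1r mul1r.
Qed.

Let measurable_gauss v : measurable_fun setT (fun x : coord R n =>
  (expR (- pi * euclidean_norm (coord_rV x - v) ^+ 2))%:E : \bar R).
Proof.
apply/measurable_EFinP; apply: measurableT_comp => //.
apply: measurable_funM => //; apply: measurable_funX.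
exact: measurable_euclidean_norm.
Qed.

(** The distance to [K] is at most the distance to one of its points, whose Gaussian has mass 1.
    Used for the positivity of [wills n V]. *)
Lemma wills_ge1 : 1 <= wills n V.
Proof.
case: K0 => k Kk; rewrite -lee_fin -integral_wills -(integral_gauss k).
apply: ge0_le_integral => // x _.
rewrite lee_fin ler_expR !mulNr lerN2 ler_pM2l ?pi_gt0//.
by rewrite ler_sqr ?nnegrE ?euclidean_norm_ge0 ?infdist_ge0// infdist_le.
Qed.

(** With [k] in [K] nearest to [y], the vector from [s *: k] to the given point is the convex
    combination of [x] and [y - k]; the squared norm is convex. *)
Lemma infdist_dilation_convex s (x y : 'rV[R]_n) : 0 < s < 1 ->
  (s * infdist K (s^-1 *: ((1 - s) *: x + s *: y))) ^+ 2 <=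
  (1 - s) * euclidean_norm x ^+ 2 + s * infdist K y ^+ 2.
Proof.
move=> /andP[s0 s1]; have [k Kk ->] := infdist_attained K0 cK y.
apply: le_trans (sqr_norm_convex x (y - k) _ _ _); last 3 first.
- by rewrite subr_ge0 ltW.
- exact: ltW.
- by rewrite subrK.
rewrite ler_sqr ?nnegrE ?euclidean_norm_ge0 ?mulr_ge0 ?infdist_ge0 ?(ltW s0)//.
apply: (@le_trans _ _ (s * euclidean_norm (s^-1 *: ((1 - s) *: x + s *: y) - k))).
  by rewrite ler_pM2l// infdist_le.
rewrite -[X in X * _](gtr0_norm s0) -euclidean_normZ scalerBr scalerA divff ?gt_eqF//.
by rewrite scale1r scalerBr addrA.
Qed.

(** The factor of weight [1 - s] in Prekopa-Leindler is the Gaussian, of mass 1, and disappears. *)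
Lemma powR_wills_le s : 0 < s < 1 -> (wills n V) `^ s <= wills_poly s.
Proof.
move=> s01; have [s0 s1] := andP s01.
have p0 : 0 < 1 - s by rewrite subr_gt0.
have := @prekopa_leindler R n (1 - s) s
  (fun x => (expR (- pi * euclidean_norm (x - 0) ^+ 2))%:E)
  (fun x => (expR (- pi * infdist K x ^+ 2))%:E)
  (fun x => (expR (- pi * (s * infdist K (s^-1 *: x)) ^+ 2))%:E)
  p0 s0 (subrK _ _) (measurable_gauss 0) measurable_gauss_dist1
  (measurable_gauss_dist s).
rewrite integral_gauss integral_wills integral_wills_poly//.
rewrite poweR1r mul1e poweR_EFin lee_fin; apply => //.
move=> x y; rewrite subr0 !poweR_EFin -EFinM lee_fin.
have := infdist_dilation_convex x y s01; rewrite -(ler_pM2l (pi_gt0 R)).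
move: (euclidean_norm x ^+ 2) (infdist K y ^+ 2) ((s * infdist K _) ^+ 2) => A B C.
rewrite -!expRM -expRD ler_expR; lra.
Qed.

(** Let [k] be nearest to [x / s] and [y = x + (1 - s) v]. The combination of [y - k] and [y - v]
    with weights [s] and [1 - s] is [x - s k], and the variance identity leaves the remainder
    [s (1 - s) |k - v|^2]. Bounding [1 - s] by 1 costs nothing to first order in [s]. *)
Lemma infdist_dilation_ball s r (v x : 'rV[R]_n) : 0 < s < 1 ->
  (forall k, K k -> euclidean_norm (k - v) <= r) ->
  s * infdist K (x + (1 - s) *: v) ^+ 2 +
  (1 - s) * euclidean_norm (x + (1 - s) *: v - v) ^+ 2 <=
  (s * infdist K (s^-1 *: x)) ^+ 2 + s * r ^+ 2.
Proof.
move=> /andP[s0 s1] Kr.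
have [k Kk ->] := infdist_attained K0 cK (s^-1 *: x).
have -> : s * euclidean_norm (s^-1 *: x - k) = euclidean_norm (x - s *: k).
  rewrite -[X in X * _](gtr0_norm s0) -euclidean_normZ scalerBr scalerA.
  by rewrite divff ?gt_eqF// scale1r.
apply: (@le_trans _ _ (s * euclidean_norm (x + (1 - s) *: v - k) ^+ 2 +
  (1 - s) * euclidean_norm (x + (1 - s) *: v - v) ^+ 2)).
  rewrite lerD2r ler_pM2l// ler_sqr ?nnegrE ?infdist_ge0 ?euclidean_norm_ge0//.
  exact: infdist_le.
have rE : euclidean_norm (k - v) ^+ 2 <= r ^+ 2.
  have kr := Kr _ Kk.
  by rewrite ler_sqr ?nnegrE ?euclidean_norm_ge0// (le_trans _ kr)// euclidean_norm_ge0.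
apply: (@le_trans _ _ (euclidean_norm (x - s *: k) ^+ 2 +
    s * (1 - s) * euclidean_norm (k - v) ^+ 2)); last first.
  rewrite lerD2l -mulrA ler_pM2l// (le_trans _ rE)//.
  by rewrite ler_piMl ?sqr_ge0// lerBlDr lerDl ltW.
rewrite le_eqVlt; apply/orP; left; apply/eqP.
rewrite !sqr_euclidean_norm !mulr_sumr -!big_split /=.
apply: eq_bigr => i _; rewrite !mxE; ring.
Qed.

(** Hoelder in its pointwise form: [g / W] and [f] have integral 1, hence so has their combination
    [h], which dominates their geometric mean. *)
Lemma wills_poly_le s r (v : 'rV[R]_n) : 0 < s < 1 ->
  (forall k, K k -> euclidean_norm (k - v) <= r) ->
  wills_poly s <= expR (s * (pi * r ^+ 2)) * (wills n V) `^ s.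
Proof.
move=> s01 Kr; have [s0 s1] := andP s01.
have W0 : 0 < wills n V by rewrite (lt_le_trans _ wills_ge1).
set W := wills n V in W0 *; set c := _ * _.
have c0 : 0 < c by rewrite mulr_gt0 ?expR_gt0 ?powR_gt0.
pose g (x : 'rV[R]_n) := expR (- pi * infdist K x ^+ 2).
pose f (x : 'rV[R]_n) := expR (- pi * euclidean_norm (x - v) ^+ 2).
pose h (x : 'rV[R]_n) : \bar R := ((s / W)%:E * (g x)%:E + (1 - s)%:E * (f x)%:E)%E.
have sW0 : 0 <= s / W by rewrite divr_ge0 ?ltW.
have q0 : 0 <= 1 - s by rewrite subr_ge0 ltW.
have mg : measurable_fun setT (fun x => (s / W)%:E * (g (@coord_rV R n x))%:E : \bar R)%E.
  exact: (measurable_funeM (s / W)%:E measurable_gauss_dist1).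
have mf : measurable_fun setT (fun x => (1 - s)%:E * (f (@coord_rV R n x))%:E : \bar R)%E.
  exact: (measurable_funeM (1 - s)%:E (measurable_gauss v)).
have mh : measurable_fun setT (h \o @coord_rV R n) by exact: emeasurable_funD.
have h0 x : (0 <= h x)%E by rewrite adde_ge0// mule_ge0 ?lee_fin ?expR_ge0.
have hint : (\int[coord_measure R n]_x h (coord_rV x) = 1)%E.
  rewrite ge0_integralD//; last 2 first.
  - by move=> x _; rewrite mule_ge0 ?lee_fin ?expR_ge0.
  - by move=> x _; rewrite mule_ge0 ?lee_fin ?expR_ge0.
  have g_ge0 (x : coord R n) (_ : setT x) : (0 <= (g (coord_rV x))%:E)%E.
    by rewrite lee_fin expR_ge0.
  have f_ge0 (x : coord R n) (_ : setT x) : (0 <= (f (coord_rV x))%:E)%E.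
    by rewrite lee_fin expR_ge0.
  have k1 : (0 <= (s / W)%:E)%E by rewrite lee_fin.
  have k2 : (0 <= (1 - s)%:E)%E by rewrite lee_fin.
  rewrite [X in (X + _)%E](@ge0_integralZl _ _ R (coord_measure R n) setT
    measurableT _ measurable_gauss_dist1 (s / W)%:E g_ge0 k1).
  rewrite [X in (_ + X)%E](@ge0_integralZl _ _ R (coord_measure R n) setT
    measurableT _ (measurable_gauss v) (1 - s)%:E f_ge0 k2).
  have gE : (\int[coord_measure R n]_x (g (coord_rV x))%:E = W%:E)%E := integral_wills.
  have fE : (\int[coord_measure R n]_x (f (coord_rV x))%:E = 1)%E := integral_gauss v.
  rewrite gE fE mule1 -EFinM divfK ?gt_eqF//.
  by rewrite -EFinD addrC subrK.
(* The pointwise bound is evaluated at [y = x + (1 - s) v]; a translation leaves the integral equal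
   to 1. *)
have hshift := integral_rV_affine ((1 - s) *: v) (@ltr01 R) mh h0.
rewrite expr1n invr1 mul1e hint in hshift.
rewrite -lee_fin -(integral_wills_poly s0) -[leRHS]mule1 -hshift.
rewrite -ge0_integralZl//; last 2 first.
- exact: measurable_rV_affine.
- by rewrite lee_fin ltW.
apply: ge0_le_integral => //.
- by apply: measurable_funeM; exact: measurable_rV_affine.
move=> x _; rewrite scale1r /h; move: (coord_rV x) => {}x.
set y := x + (1 - s) *: v.
change (expR (- pi * (s * infdist K (s^-1 *: x)) ^+ 2) <=
  c * (s / W * g y + (1 - s) * f y)).
apply: (@le_trans _ _ (c * ((g y / W) `^ s * (f y) `^ (1 - s)))); last first.
  rewrite ler_pM2l// mulrAC -mulrA.
  apply: weighted_amgm; rewrite ?subr_gt0 ?subrKC ?expR_ge0//.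
  by rewrite divr_ge0 ?expR_ge0 ?(ltW W0).
rewrite powRM ?expR_ge0 ?invr_ge0 ?(ltW W0)// /c.
rewrite (_ : _ * _ = expR (s * (pi * r ^+ 2)) * (g y `^ s * f y `^ (1 - s))); last first.
  have Ws : W `^ s * W^-1 `^ s = 1.
    by rewrite -powRM ?invr_ge0 ?(ltW W0)// divff ?gt_eqF// powR1.
  rewrite -[RHS]mulr1 -Ws.
  move: (W `^ s) (W^-1 `^ s) (g y `^ s) (f y `^ (1 - s)) (expR _) => *; ring.
rewrite /g /f -!expRM -!expRD ler_expR.
have := infdist_dilation_ball x s01 Kr; rewrite -/y.
rewrite -(ler_pM2l (pi_gt0 R)); lra.
Qed.

Lemma wills_inequalities r v : (0 < n)%N ->
  (forall k, K k -> euclidean_norm (k - v) <= r) ->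
  ln (wills n V) <= V 1%N <= ln (wills n V) + pi * r ^+ 2.
Proof.
move=> n_gt0 Kr; have W0 : 0 < wills n V by rewrite (lt_le_trans _ wills_ge1).
set L := ln (wills n V); set a := L + pi * r ^+ 2.
have WE s : wills n V `^ s = expR (L * s).
  by rewrite expRM /L lnK.
pose P := \poly_(i < n.+1) V i.
have PE s : P.[s] = wills_poly s by rewrite horner_poly.
(* [P1] comes from [e^(L s) >= 1 + L s]. For the other bound, [P s <= e^(a s)] is first multiplied
   by [e^(- a s)], since the tangent line bounds an exponential only from below. *)
pose P1 := P - (1 + L%:P * 'X); pose P2 := 1 - P * (1 - a%:P * 'X).
have P1_ge0 s : 0 < s < 1 -> 0 <= P1.[s].
  move=> s01; rewrite /P1 !hornerE PE subr_ge0; apply: le_trans (powR_wills_le s01).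
  by rewrite WE; exact: expR_ge1Dx.
have P2_ge0 s : 0 < s < 1 -> 0 <= P2.[s].
  move=> s01; rewrite /P2 !hornerE PE subr_ge0.
  have Ps0 : 0 <= wills_poly s by apply: le_trans (powR_wills_le s01); exact: powR_ge0.
  have := wills_poly_le s01 Kr; rewrite WE -expRD.
  rewrite (_ : _ + _ = a * s); last by rewrite /a; ring.
  move=> Pa; apply: (@le_trans _ _ (wills_poly s * expR (- (a * s)))).
    by rewrite ler_wpM2l// expR_ge1Dx.
  by rewrite expRN ler_pdivrMr ?expR_gt0// mul1r.
have P0 : P`_0 = V 0%N by rewrite coef_poly.
have P1E : P`_1 = V 1%N by rewrite coef_poly ltnS n_gt0.
have P10 := poly_ge0_at0 P1_ge0; have P20 := poly_ge0_at0 P2_ge0.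
(* The values of [P1] and [P2] at 0 are opposite and both nonnegative. *)
have V0 : V 0%N = 1.
  apply/eqP; rewrite eq_le; move: P10 P20.
  rewrite /P1 /P2 !hornerE horner_coef0 P0 => *; apply/andP; split; lra.
have coefs := (coefD, coefN, coefMX, coefMC, coefC, coef1).
have c1 : P1`_1 = V 1%N - L.
  rewrite /P1 !coefs /= P1E; ring.
have c2 : P2`_1 = a - V 1%N.
  by rewrite /P2 mulrBr mulr1 mulrA !coefs /= P1E P0 V0; ring.
have /poly_ge0_coef1 := P1_ge0.
rewrite c1 => /(_ _)/[!subr_ge0] -> /=; last first.
  by rewrite /P1 !coefs /= P0 V0; ring.
have /poly_ge0_coef1 := P2_ge0.
rewrite c2 subr_ge0; apply.
by rewrite /P2 mulrBr mulr1 mulrA !coefs /= P0 V0; ring.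
Qed.

End wills_inequalities.

Lemma compact_sub_ball (R : realType) n (K : set 'rV[R]_n) :
  K !=set0 -> compact K ->
  exists2 r : R, 0 < r & forall k, K k -> euclidean_norm k <= r.
Proof.
move=> K0 cK.
have [|m _ mmax] := @compact_EVT_max _ R (@euclidean_norm R n) K K0 cK.
  by apply: continuous_subspaceT; exact: continuous_euclidean_norm.
exists (euclidean_norm m + 1); first by rewrite ltr_wpDl ?euclidean_norm_ge0.
by move=> k Kk; rewrite (le_trans (mmax k _)) ?inE// lerDl.
Qed.

Theorem theorem1p2 (R : realType) (n : nat) (K : set 'rV[R]_n)
    (V : nat -> R) (n_gt0 : (0 < n)%N) (bodyK : convex_body K)
    (VK : intrinsic_volumes K V) :
  expR (V 1%N - pi * circumradius K ^+ 2) <= wills n V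
  /\ wills n V <= expR (V 1%N).
Proof.
have [K0 cK _] := bodyK.
have W0 : 0 < wills n V := lt_le_trans ltr01 (wills_ge1 K0 cK VK).
rewrite -[X in _ <= X /\ _](@lnK _ (wills n V))//.
rewrite -[X in _ /\ X <= _](@lnK _ (wills n V))//.
rewrite !ler_expR.
pose S := [set r : R | 0 <= r /\ exists x : 'rV[R]_n,
  K `<=` minkowski_sum [set x] (dilation r (@euclidean_unit_ball R n))].
have ineq r : S r -> ln (wills n V) <= V 1%N <= ln (wills n V) + pi * r ^+ 2.
  move=> [r0 [v Kv]]; apply: (wills_inequalities K0 cK VK (v := v)) => // k /Kv.
  move=> [_ -> [_ [b b1 <-] <-]].
  by rewrite addrC addKr euclidean_normZ ger0_norm// ler_piMr.
(* Any admissible radius gives the upper bound, and nonemptiness is needed to bound the infimum from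
   below. *)
have [r0 Sr0] : S !=set0.
  have [r r0 Kr] := compact_sub_ball K0 cK.
  exists r; split; first exact: ltW.
  exists 0 => k /Kr kr; exists 0 => //.
  exists k; last by rewrite add0r.
  exists (r^-1 *: k); last by rewrite scalerA divff ?scale1r ?gt_eqF.
  rewrite /euclidean_unit_ball /= euclidean_normZ ger0_norm ?invr_ge0 ?(ltW r0)//.
  by rewrite ler_pdivrMl// mulr1.
split; last by case/andP: (ineq _ Sr0).
(* Every admissible radius satisfies [a <= r ^+ 2], so [Num.sqrt a] is a lower bound of [S] and
   passes to the infimum. *)
set a := (V 1%N - ln (wills n V)) / pi.
have a0 : 0 <= a.
  by rewrite divr_ge0 ?pi_ge0// subr_ge0; case/andP: (ineq _ Sr0).
have : Num.sqrt a <= circumradius K.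
  apply: lb_le_inf; first by exists r0.
  move=> r Sr; have [/= r_ge0 _] := Sr.
  rewrite -ler_sqr ?nnegrE ?sqrtr_ge0// sqr_sqrtr//.
  rewrite ler_pdivrMr ?pi_gt0// mulrC; case/andP: (ineq _ Sr); lra.
move=> sqrta; have := sqrta; rewrite -ler_sqr ?nnegrE ?sqrtr_ge0//; last first.
  exact: le_trans (sqrtr_ge0 _) sqrta.
rewrite sqr_sqrtr// ler_pdivrMr ?pi_gt0// mulrC; lra.
Qed.
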